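(* Let $(M,J,g,\nabla,\xi)$ be a conical special Kähler manifold and let $(N=T^*M,g_N,J_1,J_2,J_3)$ be the pseudo-hyper-Kähler manifold obtained from it by the rigid c-map. Let $Z=J\xi$ and let $Z_N$ be the extension of $Z$ to $N$ defined in the context. Then $Z_N$ is a time-like or space-like Killing vector field of $(N,g_N)$ which is Hamiltonian with respect to $\omega_1=g_N(J_1\cdot,\cdot)$, and it satisfies $$D_{Z_N}Z_N=J_1Z_N\qquad\text{and}\qquad \mathcal{L}_{Z_N}J_2=-J_3,$$ where $D$ is the Levi-Civita connection of $g_N$.
   Context: A conical (affine) special Kähler manifold $(M,J,g,\nabla,\xi)$ is a pseudo-Kähler manifold $(M,J,g)$ (pseudo-Riemannian metric $g$, $g$-skew-symmetric integrable complex structure $J$, closed Kähler form $\omega=g(J\cdot,\cdot)$) endowed with a flat torsion-free connection $\nabla$ and a vector field $\xi$ such that: (i) $\nabla\omega=0$; (ii) $d^\nabla J=0$, where $J$ is considered as a one-form with values in $TM$; (iii) $\nabla\xi=D\xi=\mathrm{Id}$, where $D$ is the Levi-Civita connection; (iv) $g$ is (positive or negative) definite on the plane $\mathrm{span}\{\xi,J\xi\}$. Rigid c-map. Let $\pi:N=T^*M\to M$ be the canonical projection. Using $\nabla$ identify $TN=T^hN\oplus T^vN=\pi^*TM\oplus\pi^*T^*M$, where $T^vN=\ker d\pi$ and $T^hN$ is the horizontal distribution defined by $\nabla$. With respect to this decomposition put $$g_N=\begin{pmatrix}g&0\\0&g^{-1}\end{pmatrix},\quad J_1=\begin{pmatrix}J&0\\0&J^*\end{pmatrix},\quad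 J_2=\begin{pmatrix}0&-\omega^{-1}\\ \omega&0\end{pmatrix},\quad J_3=J_1J_2,$$ where $\omega$ is viewed as the map $TM\to T^*M$, $X\mapsto\omega(X,\cdot)$, and $J^*\lambda=\lambda\circ J$. Then $(N,g_N,J_1,J_2,J_3)$ is a pseudo-hyper-Kähler manifold. The vector field $Z_N$ on $N$ is defined by $Z_N(\pi^*q^i)=\pi^*(Z(q^i))$, $Z_N(p_i)=0$, where $(q^i)$ are $\nabla$-affine local coordinates on $M$ and $(\pi^*q^i,p_i)$ are the corresponding coordinates of $T^*M$; this is independent of the choice of affine coordinates. ''Time-like or space-like'' means that $g_N(Z_N,Z_N)$ is nowhere zero. ''Hamiltonian with respect to $\omega_1$'' means that the one-form $\omega_1(Z_N,\cdot)$ is exact. *)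

(* Defs.v *)
From HB Require Import structures.
From mathcomp Require Import all_boot all_order all_algebra.
From mathcomp Require Import all_classical all_reals all_analysis.
Set Implicit Arguments.
Unset Strict Implicit.
Unset Printing Implicit Defensive.
Import Order.TTheory GRing.Theory Num.Theory.
Import numFieldNormedType.Exports.
Local Open Scope classical_set_scope.
Local Open Scope ring_scope.

(* Conventions.  Vectors and covectors are row vectors of components.  An
   endomorphism A acts by v |-> v *m A (so "first A, then B" is A *m B), and a
   bilinear form b(v, w) = v *m B *m w^T is stored as its Gram matrix B; then
   v *m B is the covector b(v, .).  A tensor field on a manifold is given, as in
   classical tensor calculus, by its components in every chart, as functions of
   the coordinates; only their values on the image of the chart matter. *)

Section Calculus.
Context {R : realType}.

Fixpoint Ck_on (k : nat) n (V : set 'rV[R]_n) (f : 'rV[R]_n -> R) : Prop :=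
  match k with
  | 0 => forall y, V y -> {for y, continuous f}
  | k'.+1 => (forall y, V y -> differentiable f y) /\
             (forall v : 'rV[R]_n, Ck_on k' V ('D_v f))
  end.

Definition smooth_on n (V : set 'rV[R]_n) (f : 'rV[R]_n -> R) : Prop :=
  forall k, Ck_on k V f.

Definition smooth_mx_on n p q (V : set 'rV[R]_n)
    (F : 'rV[R]_n -> 'M[R]_(p, q)) : Prop :=
  forall a b, smooth_on V (fun y => F y a b).

(* the a-th partial derivative, entrywise *)
Definition pd n p q (a : 'I_n) (F : 'rV[R]_n -> 'M[R]_(p, q)) (y : 'rV[R]_n) :
    'M[R]_(p, q) :=
  \matrix_(r, s) 'D_(delta_mx 0 a : 'rV[R]_n) (fun z => F z r s) y.

Definition gradient n (f : 'rV[R]_n -> R) (y : 'rV[R]_n) : 'rV[R]_n :=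
  \row_a 'D_(delta_mx 0 a : 'rV[R]_n) f y.

(* row a is the a-th partial derivative of F *)
Definition jac_mx n m (F : 'rV[R]_n -> 'rV[R]_m) (y : 'rV[R]_n) :
    'M[R]_(n, m) :=
  \matrix_(a < n, b < m) pd a F y 0 b.

(* derivative of the components F along the vector v *)
Definition along n p q (v : 'rV[R]_n) (F : 'rV[R]_n -> 'M[R]_(p, q))
    (y : 'rV[R]_n) : 'M[R]_(p, q) :=
  \sum_(a < n) v 0 a *: pd a F y.

End Calculus.

(* inv_coord is a total function; it is meaningful only on the image. *)
Record chart (R : realType) (T : Type) (n : nat) := Chart {
  dom : set T;
  coord : T -> 'rV[R]_n;
  inv_coord : 'rV[R]_n -> T
}.

Section Charts.
Context {R : realType} {T : Type} {n : nat}.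
Implicit Types c d : chart R T n.

Definition image_of c : set 'rV[R]_n := coord c @` dom c.

Definition transition c d : 'rV[R]_n -> 'rV[R]_n := coord d \o inv_coord c.

Definition overlap c d : set 'rV[R]_n := coord c @` (dom c `&` dom d).

Definition smooth_transition c d : Prop :=
  open (overlap c d) /\ smooth_mx_on (overlap c d) (transition c d).

End Charts.

(* a homeomorphism from an open set onto an open subset of R^n *)
Definition topological_chart (R : realType) (T : topologicalType) (n : nat)
    (c : chart R T n) : Prop :=
  [/\ open (dom c), open (image_of c),
      (forall x, dom c x -> inv_coord c (coord c x) = x),
      {within dom c, continuous (coord c)} &
      {within image_of c, continuous (inv_coord c)}].

(* An indexed family of charts together with a preferred chart at every point;
   the preferred charts serve only to name the elements of T^*M below. *)
Record atlas (R : realType) (T : Type) (n : nat) := Atlas {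
  index : Type;
  chart_of : index -> chart R T n;
  chart_at : T -> index
}.

Arguments chart_of {R T n} A i : rename.
Arguments chart_at {R T n} A x : rename.

(* A smooth n-manifold: a Hausdorff second countable space with a maximal
   smooth atlas. *)
Record manifold (R : realType) (T : topologicalType) (n : nat) := Manifold {
  atlas_of :> atlas R T n;
  manifold_hausdorff : hausdorff_space T;
  manifold_second_countable : @second_countable T;
  manifold_chart : forall i, topological_chart (chart_of atlas_of i);
  manifold_cover : forall x, dom (chart_of atlas_of (chart_at atlas_of x)) x;
  manifold_smooth : forall i j,
    smooth_transition (chart_of atlas_of i) (chart_of atlas_of j);
  manifold_maximal : forall c : chart R T n, topological_chart c ->
    (forall i, smooth_transition c (chart_of atlas_of i) /\
               smooth_transition (chart_of atlas_of i) c) ->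
    exists i, dom (chart_of atlas_of i) = dom c /\
              (forall x, dom c x -> coord (chart_of atlas_of i) x = coord c x)
}.

Section TensorFields.
Context {R : realType} {T : Type} {n : nat}.
Variable A : atlas R T n.

Definition vfield := index A -> 'rV[R]_n -> 'rV[R]_n.
Definition bilin_field := index A -> 'rV[R]_n -> 'M[R]_n.
Definition endo_field := index A -> 'rV[R]_n -> 'M[R]_n.

(* Christoffel symbols: the covariant derivative of the b-th along the a-th
   coordinate field is \sum_k (G i y a) b k times the k-th coordinate field. *)
Definition connection := index A -> 'rV[R]_n -> 'I_n -> 'M[R]_n.

Definition img (i : index A) : set 'rV[R]_n := image_of (chart_of A i).
Definition jac (i j : index A) : 'rV[R]_n -> 'M[R]_n :=
  jac_mx (transition (chart_of A i) (chart_of A j)).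

Definition in_charts (P : index A -> 'rV[R]_n -> Prop) : Prop :=
  forall i y, img i y -> P i y.

Definition on_overlaps
    (P : forall i j : index A, 'rV[R]_n -> 'rV[R]_n -> Prop) : Prop :=
  forall i j x, dom (chart_of A i) x -> dom (chart_of A j) x ->
    P i j (coord (chart_of A i) x) (coord (chart_of A j) x).

Definition is_vfield (X : vfield) : Prop :=
  (forall i, smooth_mx_on (img i) (X i)) /\
  on_overlaps (fun i j y z => X i y *m jac i j y = X j z).

Definition is_bilin_field (B : bilin_field) : Prop :=
  (forall i, smooth_mx_on (img i) (B i)) /\
  on_overlaps (fun i j y z => B i y = jac i j y *m B j z *m (jac i j y)^T).

Definition is_endo_field (J : endo_field) : Prop :=
  (forall i, smooth_mx_on (img i) (J i)) /\
  on_overlaps (fun i j y z => J i y *m jac i j y = jac i j y *m J j z).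

Definition is_connection (G : connection) : Prop :=
  (forall i a, smooth_mx_on (img i) (fun y => G i y a)) /\
  on_overlaps (fun i j y z => forall a : 'I_n,
    G i y a *m jac i j y =
    pd a (jac i j) y +
    jac i j y *m (\sum_(b < n) jac i j y a b *: G j z b)).

Definition cov (G : connection) (X Y : vfield) : vfield := fun i y =>
  \sum_(a < n) X i y 0 a *: (pd a (Y i) y + Y i y *m G i y a).

(* the endomorphism v |-> nabla_v Y *)
Definition cov_endo (G : connection) (Y : vfield) : endo_field := fun i y =>
  \matrix_(a < n, b < n) (pd a (Y i) y + Y i y *m G i y a) 0 b.

Definition parallel_form (G : connection) (B : bilin_field) : Prop :=
  in_charts (fun i y => forall a : 'I_n,
    pd a (B i) y - G i y a *m B i y - B i y *m (G i y a)^T = 0).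

Definition torsion_free (G : connection) : Prop :=
  in_charts (fun i y => forall a b : 'I_n, row b (G i y a) = row a (G i y b)).

(* vanishing curvature R(d_a, d_b) = [nabla_a, nabla_b]; the order of the
   products is due to the action on rows *)
Definition flat (G : connection) : Prop :=
  in_charts (fun i y => forall a b : 'I_n,
    pd a (fun z => G i z b) y - pd b (fun z => G i z a) y
    + G i y b *m G i y a - G i y a *m G i y b = 0).

(* d^nabla J (d_a, d_b) = nabla_a (J d_b) - nabla_b (J d_a), with J d_b the
   row b of the matrix of J *)
Definition d_nabla_closed (G : connection) (J : endo_field) : Prop :=
  in_charts (fun i y => forall a b : 'I_n,
    (pd a (fun z => row b (J i z)) y + row b (J i y) *m G i y a)
    - (pd b (fun z => row a (J i z)) y + row a (J i y) *m G i y b) = 0).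

Definition is_pseudo_metric (g : bilin_field) : Prop :=
  is_bilin_field g /\
  in_charts (fun i y => (g i y)^T = g i y /\ g i y \in unitmx).

Definition is_levi_civita (g : bilin_field) (D : connection) : Prop :=
  [/\ is_connection D, torsion_free D & parallel_form D g].

(* the Nijenhuis tensor
   [J d_a, J d_b] - J [J d_a, d_b] - J [d_a, J d_b] + J^2 [d_a, d_b] *)
Definition nijenhuis (J : endo_field) (i : index A) (y : 'rV[R]_n)
    (a b : 'I_n) : 'rV[R]_n :=
  let Jd c := fun z => row c (J i z) in
  along (Jd a y) (Jd b) y - along (Jd b y) (Jd a) y
  + pd b (Jd a) y *m J i y - pd a (Jd b) y *m J i y.

Definition is_complex_structure (J : endo_field) : Prop :=
  is_endo_field J /\
  in_charts (fun i y => J i y *m J i y = - 1%:M /\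
                        (forall a b, nijenhuis J i y a b = 0)).

(* g(J ., .) *)
Definition fundamental_form (g : bilin_field) (J : endo_field) : bilin_field :=
  fun i y => J i y *m g i y.

Definition closed_2form (w : bilin_field) : Prop :=
  in_charts (fun i y => forall a b c : 'I_n,
    pd a (w i) y b c + pd b (w i) y c a + pd c (w i) y a b = 0).

Definition is_pseudo_kahler (g : bilin_field) (J : endo_field) : Prop :=
  [/\ is_pseudo_metric g, is_complex_structure J,
      in_charts (fun i y => J i y *m g i y + g i y *m (J i y)^T = 0) &
      closed_2form (fundamental_form g J)].

Definition apply_endo (J : endo_field) (X : vfield) : vfield :=
  fun i y => X i y *m J i y.

Definition pairing (g : bilin_field) (X Y : vfield) (i : index A)
    (y : 'rV[R]_n) : R :=
  (X i y *m g i y *m (Y i y)^T) 0 0.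

(* X and Y span a plane at every point, and g is definite on it *)
Definition definite_on_plane (g : bilin_field) (X Y : vfield) : Prop :=
  in_charts (fun i y =>
    let P := col_mx (X i y) (Y i y) in
    let q (v : 'rV[R]_n) := (v *m g i y *m v^T) 0 0 in
    row_free P /\
    ((forall v : 'rV[R]_n, (v <= P)%MS -> v != 0 -> 0 < q v) \/
     (forall v : 'rV[R]_n, (v <= P)%MS -> v != 0 -> q v < 0))).

(* components of the Lie derivatives of a bilinear form and of an
   endomorphism field along X *)
Definition lie_form (X : vfield) (B : bilin_field) : bilin_field := fun i y =>
  along (X i y) (B i) y + jac_mx (X i) y *m B i y
  + B i y *m (jac_mx (X i) y)^T.

Definition lie_endo (X : vfield) (J : endo_field) : endo_field := fun i y =>
  along (X i y) (J i) y + jac_mx (X i) y *m J i y - J i y *m jac_mx (X i) y.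

Definition is_killing (g : bilin_field) (X : vfield) : Prop :=
  is_vfield X /\ in_charts (fun i y => lie_form X g i y = 0).

Definition timelike_or_spacelike (g : bilin_field) (X : vfield) : Prop :=
  in_charts (fun i y => pairing g X X i y != 0).

(* the one-form w(X, .) is the differential of a global smooth function *)
Definition is_hamiltonian (w : bilin_field) (X : vfield) : Prop :=
  exists f : T -> R,
    (forall i, smooth_on (img i) (f \o inv_coord (chart_of A i))) /\
    in_charts (fun i y =>
      X i y *m w i y = gradient (f \o inv_coord (chart_of A i)) y).

End TensorFields.

(* csk_D is determined by csk_g: it is the Levi-Civita connection. *)
Record conical_special_kahler (R : realType) (T : topologicalType) (n : nat)
    (M : manifold R T n) := ConicalSpecialKahler {
  csk_J : endo_field M;
  csk_g : bilin_field M;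
  csk_nabla : connection M;
  csk_xi : vfield M;
  csk_D : connection M;
  csk_pseudo_kahler : is_pseudo_kahler csk_g csk_J;
  csk_connection : is_connection csk_nabla;
  csk_torsion_free : torsion_free csk_nabla;
  csk_flat : flat csk_nabla;
  csk_vfield : is_vfield csk_xi;
  csk_levi_civita : is_levi_civita csk_g csk_D;
  csk_parallel : parallel_form csk_nabla (fundamental_form csk_g csk_J);
  csk_d_nabla_J : d_nabla_closed csk_nabla csk_J;
  csk_nabla_xi :
    in_charts (fun i y => cov_endo csk_nabla csk_xi i y = 1%:M);
  csk_D_xi :
    in_charts (fun i y => cov_endo csk_D csk_xi i y = 1%:M);
  csk_definite : definite_on_plane csk_g csk_xi (apply_endo csk_J csk_xi)
}.

Section Cotangent.
Context {R : realType} {T : Type} {n : nat}.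
Variable A : atlas R T n.

(* The fibre T^*_x M is identified with 'rV_n through the preferred chart at x.
   The smooth structure (hence the topology) of the total space is the one of
   the charts (q, p) below, not the one of the product T * 'rV_n. *)
Definition cotangent_point : Type := (T * 'rV[R]_n)%type.

(* The chart induced by the chart i of M: u = (x, lambda) is mapped to the
   coordinates q of x and the components p of lambda with respect to dq;
   covector components transform by p_i = p_j *m (jac i j)^T. *)
Definition cotangent_chart (i : index A) :
    chart R cotangent_point (n + n)%N := {|
  dom := fun u => dom (chart_of A i) u.1;
  coord := fun u =>
    let q := coord (chart_of A i) u.1 in
    row_mx q (u.2 *m (jac i (chart_at A u.1) q)^T);
  inv_coord := fun w =>
    let x := inv_coord (chart_of A i) (lsubmx w) in
    let j := chart_at A x in
    (x, rsubmx w *m (jac j i (coord (chart_of A j) x))^T) |}.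

Definition cotangent : atlas R cotangent_point (n + n)%N := {|
  index := index A;
  chart_of := cotangent_chart;
  chart_at := fun u => chart_at A u.1 |}.

End Cotangent.

Section RigidCMap.
Context {R : realType} {T : topologicalType} {n : nat} {M : manifold R T n}.
Variable S : conical_special_kahler M.

Let N := cotangent M.

(* The isomorphism from T_uN to T_xM + T^*_xM given by the connection: a
   tangent vector with coordinate components (dq, dp) at u = (q, p) has
   horizontal part dq and vertical part
   dp_b - \sum_(a, k) dq_a (nabla_a)_(b k) p_k. *)
Definition splitting (i : index N) (w : 'rV[R]_(n + n)) : 'M[R]_(n + n) :=
  let q := lsubmx w in
  let p := rsubmx w in
  block_mx 1%:M
           (- \matrix_(a < n, b < n) (csk_nabla S i q a *m p^T) b 0)
           0 1%:M.

Definition cmap_g : bilin_field N := fun i w =>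
  let g := csk_g S i (lsubmx w) in
  splitting i w *m block_mx g 0 0 (invmx g) *m (splitting i w)^T.

Definition cmap_endo (B : index N -> 'rV[R]_n -> 'M[R]_(n + n)) :
    endo_field N := fun i w =>
  splitting i w *m B i (lsubmx w) *m invmx (splitting i w).

(* In row notation J^* is lambda |-> lambda *m J^T, and omega : TM -> T^*M is
   X |-> X *m w. *)
Definition cmap_J1 : endo_field N := cmap_endo (fun i q =>
  block_mx (csk_J S i q) 0 0 (csk_J S i q)^T).

Definition cmap_J2 : endo_field N := cmap_endo (fun i q =>
  let w := fundamental_form (csk_g S) (csk_J S) i q in
  block_mx 0 w (- invmx w) 0).

(* J_3 = J_1 J_2, i.e. first J_2 and then J_1 *)
Definition cmap_J3 : endo_field N := fun i w => cmap_J2 i w *m cmap_J1 i w.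

Definition affine_chart (i : index M) : Prop :=
  forall q, img i q -> forall a : 'I_n, csk_nabla S i q a = 0.

(* Z_N is given by Z_N(q^a) = Z(q^a), Z_N(p_a) = 0 in the coordinates (q, p)
   induced by nabla-affine coordinates q, which exist around every point as
   nabla is flat and torsion-free; the choice of q is immaterial. *)
Definition is_cmap_extension (Z : vfield M) (ZN : vfield N) : Prop :=
  is_vfield ZN /\
  forall x : T, exists i : index M,
    [/\ affine_chart i, dom (chart_of M i) x &
        forall w, img (A := N) i w -> ZN i w = row_mx (Z i (lsubmx w)) 0].

End RigidCMap.

(* Main.v *)
Require Import Defs.
From HB Require Import structures.
From mathcomp Require Import all_boot all_order all_algebra.
From mathcomp Require Import all_classical all_reals all_analysis.
From mathcomp Require Import ring.
Set Implicit Arguments.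
Unset Strict Implicit.
Unset Printing Implicit Defensive.
Import Order.TTheory GRing.Theory Num.Theory.
Import numFieldNormedType.Exports.
Local Open Scope classical_set_scope.
Local Open Scope ring_scope.

(* Tensor identities are checked in an arbitrary chart, with G(v) the
   contraction of the Christoffel symbols of nabla with v.

   On M: nabla xi = D xi says that nabla and D have the same contraction with
   xi.  Hence the nabla-parallel form omega and the D-parallel metric g are
   transported alike along xi, and nabla_xi J = 0.  As nabla J is symmetric
   (d^nabla J = 0) and anticommutes with J, this gives nabla Z = J and
   nabla_Z J = 0 for Z = J xi; with nabla omega = 0 it follows that
   nabla_Z g = 0 and L_Z g = 0.

   On N = T^*M: in affine coordinates Z_N is visibly the nabla-horizontal lift
   of Z, hence so it is in all charts.  Flatness of nabla makes the Lie
   derivative along Z_N of the frame TN = T^hN + T^vN block diagonal, with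
   blocks dZ and G(Z)^T, so that the Lie derivatives of g_N and J_2 reduce to
   the identities on M.  Finally g_N(Z_N, Z_N) = g(Z, Z) = g(xi, xi), whose
   differential is 2 g(xi, .) = -2 g_N(J_1 Z_N, .): this gives the Hamiltonian
   - g(xi, xi) / 2 and, Z_N being Killing, its acceleration. *)

(** * Partial derivatives of matrix-valued functions *)

Section MatrixCalculus.
Context {R : realType}.

(** [g - f] vanishes near [y], so it is its own [o(h)] remainder and has differential zero there;
    adding it to [f] preserves differentiability. *)
Lemma near_eq_differentiable (V W : normedModType R) (f g : V -> W) (y : V) :
  (\near y, f y = g y) -> differentiable f y -> differentiable g y.
Proof.
move=> fg df; have -> : g = f + (g - f) by rewrite addrC subrK.
apply: differentiableD => //.
have [c0 hP] : continuous (0 : V -> W) /\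
    (g - f) \o shift y = cst ((g - f) y) + (0 : V -> W) +o_ 0 id.
  split; first by move=> ?; exact: cst_continuous.
  apply/eqaddoP => e e0; near=> h.
  rewrite /= !fctE /= (nbhs_singleton fg) subrr addr0 subr0.
  suff -> : f (h + y) = g (h + y) by rewrite subrr normr0 mulr_ge0// ltW.
  near: h; have := fg; rewrite (near_shift 0) /=.
  by apply: filterS => h /=; rewrite subr0.
have d0 : 'd (g - f) y = 0 :> (V -> W) by exact/diff_unique.
by apply/diff_locallyP; rewrite d0.
Unshelve. all: by end_near. Qed.

(** Entrywise, to match [pd], which also differentiates entry by entry. *)
Definition mx_differentiable n p q (F : 'rV[R]_n -> 'M[R]_(p, q)) y :=
  forall a b, differentiable (fun z => F z a b) y.

Lemma differentiable_bigsum (V : normedModType R) (I : Type) (r : seq I)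
    (P : pred I) (f : I -> V -> R) y :
  (forall i, differentiable (f i) y) ->
  differentiable (fun z => \sum_(i <- r | P i) f i z) y.
Proof.
move=> df.
rewrite (_ : (fun z => _) = \sum_(i <- r | P i) f i); last first.
  by apply/funext => z; rewrite fct_sumE.
by elim/big_ind : _ => // ? ? ? ?; exact: differentiableD.
Qed.

Lemma differentiable_bigprod (V : normedModType R) (I : Type) (r : seq I)
    (f : I -> V -> R) y :
  (forall i, differentiable (f i) y) ->
  differentiable (fun z => \prod_(i <- r) f i z) y.
Proof.
move=> df; elim: r => [|i r IH].
  by under eq_fun do rewrite big_nil; exact: differentiable_cst.
under eq_fun do rewrite big_cons.
exact: differentiableM.
Qed.

Lemma derive_bigsum (V : normedModType R) n
    (f : 'I_n -> V -> R) y v :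
  (forall i, differentiable (f i) y) ->
  'D_v (fun z => \sum_(i < n) f i z) y = \sum_(i < n) 'D_v (f i) y.
Proof.
move=> df.
rewrite (_ : (fun z => _) = \sum_(i < n) f i); last first.
  by apply/funext => z; rewrite fct_sumE.
by rewrite derive_sum // => i; exact: diff_derivable.
Qed.

Lemma derive_mul (V : normedModType R) (f g : V -> R) y v :
  differentiable f y -> differentiable g y ->
  'D_v (fun z => f z * g z) y = 'D_v f y * g y + f y * 'D_v g y.
Proof.
move=> df dg; rewrite deriveM; do ?exact: diff_derivable.
by rewrite addrC /GRing.scale /= [g y * _]mulrC.
Qed.

Section Rules.
Variables (n : nat) (y : 'rV[R]_n).

Lemma mxdiff_cst p q (M : 'M[R]_(p, q)) :
  mx_differentiable (fun _ : 'rV[R]_n => M) y.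
Proof. by move=> a b; exact: differentiable_cst. Qed.

Lemma mxdiffN p q (F : 'rV[R]_n -> 'M[R]_(p, q)) :
  mx_differentiable F y -> mx_differentiable (fun z => - F z) y.
Proof.
by move=> dF a b; under eq_fun do rewrite mxE; exact: differentiableN.
Qed.

Lemma mxdiff_tr p q (F : 'rV[R]_n -> 'M[R]_(p, q)) :
  mx_differentiable F y -> mx_differentiable (fun z => (F z)^T) y.
Proof. by move=> dF a b; under eq_fun do rewrite mxE; exact: dF. Qed.

Lemma mxdiffM p q r (F : 'rV[R]_n -> 'M[R]_(p, q))
    (G : 'rV[R]_n -> 'M[R]_(q, r)) :
  mx_differentiable F y -> mx_differentiable G y ->
  mx_differentiable (fun z => F z *m G z) y.
Proof.
move=> dF dG a b; under eq_fun do rewrite mxE.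
by apply: differentiable_bigsum => i; exact: differentiableM.
Qed.

Lemma differentiable_det m (F : 'rV[R]_n -> 'M[R]_m) :
  mx_differentiable F y -> differentiable (fun z => \det (F z)) y.
Proof.
move=> dF; rewrite /determinant; apply: differentiable_bigsum => s.
apply: differentiableM; first exact: differentiable_cst.
exact: differentiable_bigprod.
Qed.

(** Cramer's formula: determinant and cofactors are polynomials in the entries. Invertibility is
    asked near [y] because the formula describes [invmx] only at invertible matrices; a singular one
    is returned unchanged. *)
Lemma mxdiff_inv m (F : 'rV[R]_n -> 'M[R]_m) :
  (\forall z \near y, F z \in unitmx) -> mx_differentiable F y ->
  mx_differentiable (fun z => invmx (F z)) y.
Proof.
move=> Fu dF a b.
apply: (near_eq_differentiable (f := fun z => (\det (F z))^-1 * \adj (F z) a b)).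
  by apply: filterS Fu => z Fz; rewrite /invmx Fz [RHS]mxE.
apply: differentiableM.
  apply: differentiableV; first exact: differentiable_det.
  by have := nbhs_singleton Fu; rewrite unitmxE unitfE.
under eq_fun do rewrite mxE /cofactor.
apply: differentiableM; first exact: differentiable_cst.
by apply: differentiable_det => i j; under eq_fun do rewrite !mxE; exact: dF.
Qed.

Lemma near_eq_pd p q a (F G : 'rV[R]_n -> 'M[R]_(p, q)) :
  (\forall z \near y, F z = G z) -> pd a F y = pd a G y.
Proof.
move=> FG; apply/matrixP => i j; rewrite !mxE; apply: near_eq_derive.
by near=> z; rewrite (near FG z).
Unshelve. all: by end_near. Qed.

Lemma pd_cst p q a (M : 'M[R]_(p, q)) : pd a (fun _ => M) y = 0.
Proof. by apply/matrixP => i j; rewrite !mxE derive_cst. Qed.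

Lemma pdN p q a (F : 'rV[R]_n -> 'M[R]_(p, q)) :
  mx_differentiable F y -> pd a (fun z => - F z) y = - pd a F y.
Proof.
move=> dF; apply/matrixP => i j; rewrite !mxE.
under eq_fun do rewrite mxE.
by rewrite deriveN //; exact: diff_derivable.
Qed.

Lemma pdM p q r a (F : 'rV[R]_n -> 'M[R]_(p, q))
    (G : 'rV[R]_n -> 'M[R]_(q, r)) :
  mx_differentiable F y -> mx_differentiable G y ->
  pd a (fun z => F z *m G z) y = pd a F y *m G y + F y *m pd a G y.
Proof.
move=> dF dG; apply/matrixP => i j; rewrite !mxE.
under eq_fun do rewrite mxE.
rewrite derive_bigsum; last by move=> k; exact: differentiableM.
rewrite -big_split /=; apply: eq_bigr => k _.
by rewrite derive_mul // !mxE.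
Qed.

Lemma pd_tr p q a (F : 'rV[R]_n -> 'M[R]_(p, q)) :
  pd a (fun z => (F z)^T) y = (pd a F y)^T.
Proof.
by apply/matrixP => i j; rewrite !mxE; under eq_fun do rewrite mxE.
Qed.

Lemma pd_row p q a b (F : 'rV[R]_n -> 'M[R]_(p, q)) :
  pd a (fun z => row b (F z)) y = row b (pd a F y).
Proof.
by apply/matrixP => i j; rewrite !mxE; under eq_fun do rewrite mxE.
Qed.

Lemma row_jac m a (F : 'rV[R]_n -> 'rV[R]_m) : row a (jac_mx F y) = pd a F y.
Proof. by apply/rowP => b; rewrite !mxE. Qed.

(** Differentiate the identity [F *m invmx F = 1], which holds near [y]. *)
Lemma pd_inv m a (F : 'rV[R]_n -> 'M[R]_m) :
  (\forall z \near y, F z \in unitmx) -> mx_differentiable F y ->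
  pd a (fun z => invmx (F z)) y = - (invmx (F y) *m pd a F y *m invmx (F y)).
Proof.
move=> Fu dF; have Fy := nbhs_singleton Fu.
have : pd a (fun z => F z *m invmx (F z)) y = 0.
  rewrite -(pd_cst a (1%:M : 'M[R]_m)); apply: near_eq_pd.
  by near=> z; rewrite mulmxV // (near Fu z).
rewrite pdM //; last exact: mxdiff_inv.
move=> /eqP; rewrite addrC addr_eq0 => /eqP E.
by rewrite -[LHS](mulKmx Fy) E mulmxN mulmxA.
Unshelve. all: by end_near. Qed.

Lemma alongM p q r v (F : 'rV[R]_n -> 'M[R]_(p, q))
    (G : 'rV[R]_n -> 'M[R]_(q, r)) :
  mx_differentiable F y -> mx_differentiable G y ->
  along v (fun z => F z *m G z) y = along v F y *m G y + F y *m along v G y.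
Proof.
move=> dF dG; rewrite /along mulmx_suml mulmx_sumr -big_split /=.
by apply: eq_bigr => a _; rewrite pdM // scalerDr scalemxAl scalemxAr.
Qed.

Lemma alongN p q v (F : 'rV[R]_n -> 'M[R]_(p, q)) :
  mx_differentiable F y -> along v (fun z => - F z) y = - along v F y.
Proof.
move=> dF; rewrite /along -sumrN; apply: eq_bigr => a _.
by rewrite pdN // scalerN.
Qed.

Lemma along_tr p q v (F : 'rV[R]_n -> 'M[R]_(p, q)) :
  along v (fun z => (F z)^T) y = (along v F y)^T.
Proof.
rewrite /along linear_sum /=; apply: eq_bigr => a _.
by rewrite pd_tr linearZ.
Qed.

Lemma along_inv m v (F : 'rV[R]_n -> 'M[R]_m) :
  (\forall z \near y, F z \in unitmx) -> mx_differentiable F y ->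
  along v (fun z => invmx (F z)) y = - (invmx (F y) *m along v F y *m invmx (F y)).
Proof.
move=> Fu dF; rewrite /along mulmx_sumr mulmx_suml -sumrN.
by apply: eq_bigr => a _; rewrite pd_inv // scalerN scalemxAl scalemxAr.
Qed.

Lemma row_along_jac m v (F : 'rV[R]_n -> 'rV[R]_m) :
  along v F y = v *m jac_mx F y.
Proof.
apply/rowP => b; rewrite summxE !mxE; apply: eq_bigr => a _.
by rewrite !mxE.
Qed.

Lemma differentiable_rV m (F : 'rV[R]_n -> 'rV[R]_m) :
  mx_differentiable F y -> differentiable F y.
Proof.
move=> dF.
rewrite (_ : F = \sum_(b < m) (fun z => F z 0 b *: delta_mx 0 b)).
  by apply: differentiable_sum => b; exact: differentiableZl.
apply/funext => z; rewrite fct_sumE; exact: row_sum_delta.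
Qed.

(** The chain rule in coordinates: the derivative of [F] is expanded in the standard basis, and the
    differential of [f] is linear. *)
Lemma derive_comp_rV m (F : 'rV[R]_n -> 'rV[R]_m) (f : 'rV[R]_m -> R) v :
  mx_differentiable F y -> differentiable f (F y) ->
  'D_v (f \o F) y = \sum_b 'D_v (fun z => F z 0 b) y * 'D_(delta_mx 0 b) f (F y).
Proof.
move=> dF df; have dF' := differentiable_rV dF.
rewrite deriveE; last exact: differentiable_comp.
rewrite diff_comp //= -(deriveE v dF') derive_mx; last exact: diff_derivable.
rewrite [X in 'd f _ X]row_sum_delta linear_sum.
by apply: eq_bigr => b _; rewrite linearZ mxE -deriveE.
Qed.

Lemma jac_comp m k (F : 'rV[R]_n -> 'rV[R]_m) (G : 'rV[R]_m -> 'rV[R]_k) :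
  mx_differentiable F y -> mx_differentiable G (F y) ->
  jac_mx (G \o F) y = jac_mx F y *m jac_mx G (F y).
Proof.
move=> dF dG; apply/matrixP => a c; rewrite !mxE.
rewrite (derive_comp_rV _ (f := fun z => G z 0 c)) //.
by apply: eq_bigr => b _; rewrite !mxE.
Qed.

End Rules.

(** As [lsubmx] is linear, the two difference quotients agree for every [h]. *)
Lemma derive_lsubmx n m (f : 'rV[R]_n -> R) (v w : 'rV[R]_(n + m)) :
  'D_v (fun z => f (lsubmx z)) w = 'D_(lsubmx v) f (lsubmx w).
Proof.
rewrite /derive; apply: (congr1 (fun g => lim (g @ 0^'))); apply/funext => h.
rewrite /= (_ : lsubmx (h *: v + w) = h *: lsubmx v + lsubmx w) //.
by apply/matrixP => i j; rewrite !mxE.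
Qed.

Lemma mxdiff_lsubmx n m p q (F : 'rV[R]_n -> 'M[R]_(p, q)) (w : 'rV[R]_(n + m)) :
  mx_differentiable F (lsubmx w) -> mx_differentiable (fun z => F (lsubmx z)) w.
Proof.
move=> dF a b.
apply: (@differentiable_comp _ _ _ _ lsubmx (fun z => F z a b)) => //.
exact: differentiable_lsubmx.
Qed.

Lemma mxdiff_rsubmx_id n m (w : 'rV[R]_(n + m)) :
  mx_differentiable (fun z : 'rV[R]_(n + m) => rsubmx z) w.
Proof.
move=> a b; apply: (@differentiable_comp _ _ _ _ rsubmx (fun z => z a b)).
  exact: differentiable_rsubmx.
exact: differentiable_coord.
Qed.

Lemma pd_lshift n m p q a (F : 'rV[R]_n -> 'M[R]_(p, q)) (w : 'rV[R]_(n + m)) :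
  pd (lshift m a) (fun z => F (lsubmx z)) w = pd a F (lsubmx w).
Proof.
apply/matrixP => i j; rewrite !mxE (derive_lsubmx (fun z => F z i j)).
by congr ('D_ _ _ _); apply/rowP => k; rewrite !mxE (inj_eq (@lshift_inj _ _)).
Qed.

Lemma pd_rshift n m p q a (F : 'rV[R]_n -> 'M[R]_(p, q)) (w : 'rV[R]_(n + m)) :
  pd (rshift n a) (fun z => F (lsubmx z)) w = 0.
Proof.
apply/matrixP => i j; rewrite !mxE (derive_lsubmx (fun z => F z i j)).
have -> : lsubmx (delta_mx 0 (rshift n a)) = 0 :> 'rV[R]_n.
  by apply/rowP => k; rewrite !mxE eq_lrshift andbF.
by rewrite derive0.
Qed.

Lemma pd_id n a (w : 'rV[R]_n) : pd a id w = delta_mx 0 a.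
Proof.
rewrite -[RHS](@derive_id _ _ w) derive_mx; last exact: derivable_id.
by apply/matrixP => i j; rewrite !mxE.
Qed.

Lemma jac_id n (w : 'rV[R]_n) : jac_mx id w = 1%:M.
Proof. by apply/row_matrixP => a; rewrite row_jac pd_id row1. Qed.

Lemma along_lsubmx n m p q (F : 'rV[R]_n -> 'M[R]_(p, q)) (v w : 'rV[R]_(n + m)) :
  along v (fun z => F (lsubmx z)) w = along (lsubmx v) F (lsubmx w).
Proof.
rewrite /along big_split_ord /= [X in _ + X]big1 ?addr0; last first.
  by move=> a _; rewrite pd_rshift scaler0.
by apply: eq_bigr => a _; rewrite pd_lshift mxE.
Qed.

(** * Smooth functions on an open set *)

Section Smooth.
Variables (n : nat) (V : set 'rV[R]_n).
Hypothesis Vo : open V.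

Lemma smooth_on_differentiable (f : 'rV[R]_n -> R) y :
  smooth_on V f -> V y -> differentiable f y.
Proof. by move=> /(_ 1) /= [+ _] Vy; exact. Qed.

Lemma smooth_on_derive (f : 'rV[R]_n -> R) v :
  smooth_on V f -> smooth_on V ('D_v f).
Proof. by move=> sf k; have [_] := sf k.+1; exact. Qed.

Lemma near_open (P : 'rV[R]_n -> Prop) y :
  V y -> (forall z, V z -> P z) -> \forall z \near y, P z.
Proof. by move=> Vy VP; apply: filterS VP _; exact: open_nbhs_nbhs. Qed.

(** On an open set, agreement at all points is agreement near each point, so it passes to all
    directional derivatives and the induction on [k] goes through. *)
Lemma eq_Ck_on k (f g : 'rV[R]_n -> R) :
  (forall y, V y -> f y = g y) -> Ck_on k V f -> Ck_on k V g.
Proof.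
elim: k f g => [|k IH] f g fg /=.
  move=> cf y Vy; have fgy : {near y, f =1 g} := near_open Vy fg.
  have := cf y Vy; rewrite /prop_for /continuous_at (fg y Vy).
  exact: cvg_trans (near_eq_cvg fgy).
move=> [df cf]; split=> [y Vy|v].
  by apply: near_eq_differentiable (df y Vy); exact: near_open fg.
apply: IH (cf v) => y Vy.
by apply: near_eq_derive; exact: near_open fg.
Qed.

Lemma eq_smooth_on (f g : 'rV[R]_n -> R) :
  (forall y, V y -> f y = g y) -> smooth_on V f -> smooth_on V g.
Proof. by move=> fg sf k; exact: eq_Ck_on (sf k). Qed.

Lemma smooth_on_cst (c : R) : smooth_on V (fun _ => c).
Proof.
move=> k; elim: k c => [|k IH] c /=; first by move=> y _; exact: cst_continuous.
split=> [y _|v]; first exact: differentiable_cst.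
rewrite (_ : 'D_v _ = fun _ => 0) //.
by apply/funext => y; rewrite derive_cst.
Qed.

Lemma Ck_onD k (f g : 'rV[R]_n -> R) :
  Ck_on k V f -> Ck_on k V g -> Ck_on k V (fun y => f y + g y).
Proof.
elim: k f g => [|k IH] f g /= => [cf cg y Vy|[df cf] [dg cg]].
  exact: (continuousD (cf y Vy) (cg y Vy)).
split=> [y Vy|v]; first by apply: differentiableD; [exact: df | exact: dg].
apply: eq_Ck_on (IH _ _ (cf v) (cg v)) => y Vy.
by rewrite deriveD //; apply: diff_derivable; [exact: df | exact: dg].
Qed.

(** The induction on the order keeps both factors smooth: each term of the Leibniz rule is again a
    product of smooth functions. *)
Lemma smooth_onM (f g : 'rV[R]_n -> R) :
  smooth_on V f -> smooth_on V g -> smooth_on V (fun y => f y * g y).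
Proof.
move=> + + k; elim: k f g => [|k IH] f g sf sg /=.
  move=> y Vy; apply: differentiable_continuous.
  by apply: differentiableM; exact: smooth_on_differentiable.
split=> [y Vy|v].
  by apply: differentiableM; exact: smooth_on_differentiable.
apply: eq_Ck_on (Ck_onD (IH _ _ (smooth_on_derive v sf) sg)
                        (IH _ _ sf (smooth_on_derive v sg))) => y Vy.
by rewrite derive_mul //; exact: smooth_on_differentiable.
Qed.

Lemma smooth_on_sum (I : Type) (r : seq I) (f : I -> 'rV[R]_n -> R) :
  (forall i, smooth_on V (f i)) -> smooth_on V (fun y => \sum_(i <- r) f i y).
Proof.
move=> sf; elim: r => [|i r IH].
  by under eq_fun do rewrite big_nil; exact: smooth_on_cst.
by under eq_fun do rewrite big_cons; move=> k; apply: Ck_onD; [exact: sf | exact: IH].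
Qed.

Lemma smooth_mx_onM p q r (F : 'rV[R]_n -> 'M[R]_(p, q))
    (G : 'rV[R]_n -> 'M[R]_(q, r)) :
  smooth_mx_on V F -> smooth_mx_on V G -> smooth_mx_on V (fun y => F y *m G y).
Proof.
move=> sF sG a b; under eq_fun do rewrite mxE.
by apply: smooth_on_sum => i; exact: smooth_onM.
Qed.

Lemma smooth_mx_on_tr p q (F : 'rV[R]_n -> 'M[R]_(p, q)) :
  smooth_mx_on V F -> smooth_mx_on V (fun y => (F y)^T).
Proof. by move=> sF a b; under eq_fun do rewrite mxE; exact: sF. Qed.

Lemma smooth_mx_on_mxdiff p q (F : 'rV[R]_n -> 'M[R]_(p, q)) y :
  smooth_mx_on V F -> V y -> mx_differentiable F y.
Proof. by move=> sF Vy a b; exact: smooth_on_differentiable. Qed.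

Lemma smooth_mx_on_jac m (F : 'rV[R]_n -> 'rV[R]_m) :
  smooth_mx_on V F -> smooth_mx_on V (jac_mx F).
Proof.
move=> sF a b; rewrite (_ : (fun y => _) = 'D_(delta_mx 0 a) (fun z => F z 0 b)).
  exact: smooth_on_derive.
by apply/funext => y; rewrite !mxE.
Qed.

End Smooth.

(** Directional derivatives of a pullback are pullbacks of directional derivatives, whence an
    induction on the order. *)
Lemma smooth_on_lsubmx n m (V : set 'rV[R]_n) (f : 'rV[R]_n -> R) :
  smooth_on V f ->
  smooth_on (lsubmx @^-1` V : set 'rV[R]_(n + m)) (fun w => f (lsubmx w)).
Proof.
move=> + k; elim: k f => [|k IH] f sf /=.
  move=> y Vy; apply: differentiable_continuous.
  apply: (@differentiable_comp _ _ _ _ lsubmx f).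
    exact: differentiable_lsubmx.
  exact: smooth_on_differentiable sf _.
split=> [y Vy|v].
  apply: (@differentiable_comp _ _ _ _ lsubmx f).
    exact: differentiable_lsubmx.
  exact: smooth_on_differentiable sf _.
rewrite (_ : 'D_v _ = fun w => 'D_(lsubmx v) f (lsubmx w)).
  exact: (IH _ (smooth_on_derive (lsubmx v) sf)).
by apply/funext => w; rewrite derive_lsubmx.
Qed.

End MatrixCalculus.

(** * Derivatives of block matrices and of base and fibre coordinates *)

Section BlockCalculus.
Context {R : realType}.
Implicit Type k : nat.

Lemma pd_row_mx k p q1 q2 a (F : 'rV[R]_k -> 'M[R]_(p, q1))
    (G : 'rV[R]_k -> 'M[R]_(p, q2)) y :
  pd a (fun z => row_mx (F z) (G z)) y = row_mx (pd a F y) (pd a G y).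
Proof.
apply/matrixP => r s; rewrite !mxE; under eq_fun do rewrite mxE.
by case: (fintype.split s) => j; rewrite mxE.
Qed.

Lemma mxdiff_row_mx k p q1 q2 (F : 'rV[R]_k -> 'M[R]_(p, q1))
    (G : 'rV[R]_k -> 'M[R]_(p, q2)) y :
  mx_differentiable F y -> mx_differentiable G y ->
  mx_differentiable (fun z => row_mx (F z) (G z)) y.
Proof.
move=> dF dG r s; under eq_fun do rewrite mxE.
by case: (fintype.split s).
Qed.

Lemma mxdiff_col_mx k p1 p2 q (F : 'rV[R]_k -> 'M[R]_(p1, q))
    (G : 'rV[R]_k -> 'M[R]_(p2, q)) y :
  mx_differentiable F y -> mx_differentiable G y ->
  mx_differentiable (fun z => col_mx (F z) (G z)) y.
Proof.
move=> dF dG r s; under eq_fun do rewrite mxE.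
by case: (fintype.split r).
Qed.

Lemma pd_rsubmx n m a (w : 'rV[R]_(n + m)) :
  pd a (fun z => rsubmx z) w = rsubmx (delta_mx 0 a).
Proof.
rewrite -(pd_id a w).
by apply/matrixP => i j; rewrite !mxE; under eq_fun do rewrite mxE.
Qed.

Lemma pd_lshift_rsubmx n m a (w : 'rV[R]_(n + m)) :
  pd (lshift m a) (fun z => rsubmx z) w = 0.
Proof.
by rewrite pd_rsubmx; apply/rowP => b; rewrite !mxE eq_rlshift andbF.
Qed.

Lemma pd_rshift_rsubmx n m a (w : 'rV[R]_(n + m)) :
  pd (rshift n a) (fun z => rsubmx z) w = delta_mx 0 a.
Proof.
by rewrite pd_rsubmx; apply/rowP => b; rewrite !mxE (inj_eq (@rshift_inj _ _)).
Qed.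

Lemma mxdiff_rows k p1 q1 (F : 'rV[R]_k -> 'M[R]_(p1, q1)) y :
  (forall a, mx_differentiable (fun z => row a (F z)) y) ->
  mx_differentiable F y.
Proof.
move=> dF a b; rewrite (_ : (fun z => _) = fun z => row a (F z) 0 b).
  exact: dF.
by apply/funext => z; rewrite mxE.
Qed.

Lemma alongE n p q (v : 'rV[R]_n) (F : 'rV[R]_n -> 'M[R]_(p, q)) y r s :
  along v F y r s =
  \sum_(a < n) v 0 a * 'D_(delta_mx 0 a : 'rV[R]_n) (fun z => F z r s) y.
Proof. by rewrite summxE; apply: eq_bigr => a _; rewrite !mxE. Qed.

Lemma along_row_mx n p q1 q2 (v : 'rV[R]_n) (F : 'rV[R]_n -> 'M[R]_(p, q1))
    (G : 'rV[R]_n -> 'M[R]_(p, q2)) y :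
  along v (fun z => row_mx (F z) (G z)) y = row_mx (along v F y) (along v G y).
Proof.
rewrite /along; apply/matrixP => r s; rewrite mxE alongE.
under [LHS]eq_bigr do under eq_fun do rewrite mxE.
by case: (fintype.split s) => j; rewrite alongE.
Qed.

Lemma along_col_mx n p1 p2 q (v : 'rV[R]_n) (F : 'rV[R]_n -> 'M[R]_(p1, q))
    (G : 'rV[R]_n -> 'M[R]_(p2, q)) y :
  along v (fun z => col_mx (F z) (G z)) y = col_mx (along v F y) (along v G y).
Proof.
rewrite /along; apply/matrixP => r s; rewrite mxE alongE.
under [LHS]eq_bigr do under eq_fun do rewrite mxE.
by case: (fintype.split r) => j; rewrite alongE.
Qed.

Lemma along_cst n p q (v : 'rV[R]_n) (M : 'M[R]_(p, q)) y :
  along v (fun _ => M) y = 0.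
Proof. by rewrite /along big1 // => a _; rewrite pd_cst scaler0. Qed.

Lemma along_block_mx n p1 p2 q1 q2 (v : 'rV[R]_n)
    (F11 : 'rV[R]_n -> 'M[R]_(p1, q1)) (F12 : 'rV[R]_n -> 'M[R]_(p1, q2))
    (F21 : 'rV[R]_n -> 'M[R]_(p2, q1)) (F22 : 'rV[R]_n -> 'M[R]_(p2, q2)) y :
  along v (fun z => block_mx (F11 z) (F12 z) (F21 z) (F22 z)) y =
  block_mx (along v F11 y) (along v F12 y) (along v F21 y) (along v F22 y).
Proof. by rewrite /block_mx along_col_mx !along_row_mx. Qed.

Lemma mxdiff_block_mx n p1 p2 q1 q2
    (F11 : 'rV[R]_n -> 'M[R]_(p1, q1)) (F12 : 'rV[R]_n -> 'M[R]_(p1, q2))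
    (F21 : 'rV[R]_n -> 'M[R]_(p2, q1)) (F22 : 'rV[R]_n -> 'M[R]_(p2, q2)) y :
  mx_differentiable F11 y -> mx_differentiable F12 y ->
  mx_differentiable F21 y -> mx_differentiable F22 y ->
  mx_differentiable (fun z => block_mx (F11 z) (F12 z) (F21 z) (F22 z)) y.
Proof.
by move=> d11 d12 d21 d22; apply: mxdiff_col_mx; exact: mxdiff_row_mx.
Qed.

Lemma gradient_lsubmx n m (f : 'rV[R]_n -> R) (w : 'rV[R]_(n + m)) :
  gradient (fun z => f (lsubmx z)) w = row_mx (gradient f (lsubmx w)) 0.
Proof.
(* Reading [f] as a 1 x 1 matrix makes the rules for [pd] applicable. *)
pose F y : 'M[R]_1 := (f y)%:M.
have FE (y : 'rV[R]_n) a : 'D_(delta_mx 0 a) f y = pd a F y 0 0.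
  by rewrite mxE; congr ('D_ _ _ _); apply/funext => z; rewrite mxE eqxx.
have FEw (y : 'rV[R]_(n + m)) a :
    'D_(delta_mx 0 a) (fun z => f (lsubmx z)) y = pd a (fun z => F (lsubmx z)) y 0 0.
  by rewrite mxE; congr ('D_ _ _ _); apply/funext => z; rewrite mxE eqxx.
apply/rowP => a; rewrite mxE FEw -[a]splitK.
case: (fintype.split a) => b; rewrite [unsplit _]/=.
  by rewrite row_mxEl [RHS]mxE FE pd_lshift.
by rewrite row_mxEr pd_rshift !mxE.
Qed.

End BlockCalculus.

(** * Vector fields and connections *)

(* Proves an identity in the abelian group of matrices, products being atoms. *)
Ltac mx_abel :=
  repeat match goal with
  | |- context [@mulmx ?S ?a ?b ?c ?A ?B] =>
      let P := fresh "P" in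
      move: (@mulmx S a b c A B) => P
  end;
  apply/matrixP => ? ?; rewrite ?mxE; ring.

Section Contraction.
Context {R : realType} {n : nat}.

(** The connection form of [G] evaluated on [v]: row b holds the components of the covariant
    derivative along [v] of the b-th coordinate field. *)
Definition contract (v : 'rV[R]_n) (G : 'I_n -> 'M[R]_n) : 'M[R]_n :=
  \sum_(a < n) v 0 a *: G a.

(** Symmetry in the two lower indices exchanges the direction of differentiation with the argument.
    It serves both for torsion-free connections and for the tensor nabla J. *)
Lemma mulmx_contract (G : 'I_n -> 'M[R]_n) (v : 'rV[R]_n) a :
  (forall a b, row b (G a) = row a (G b)) -> v *m G a = row a (contract v G).
Proof.
move=> sG; rewrite mulmx_sum_row /contract linear_sum.
by apply: eq_bigr => b _; rewrite sG linearZ.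
Qed.

End Contraction.

Section TensorCalculus.
Context {R : realType} {T : Type} {n : nat} {A : atlas R T n}.

Lemma cov_endoE (G : connection A) (Y : vfield A) i y :
  torsion_free G -> img i y ->
  cov_endo G Y i y = jac_mx (Y i) y + contract (Y i y) (G i y).
Proof.
move=> tG iy; apply/row_matrixP => a.
have -> : row a (cov_endo G Y i y) = pd a (Y i) y + Y i y *m G i y a.
  by apply/rowP => b; rewrite !mxE.
by rewrite linearD /= row_jac (mulmx_contract _ _ (tG i y iy)).
Qed.

Lemma along_parallel (G : connection A) (B : bilin_field A) v i y :
  parallel_form G B -> img i y ->
  along v (B i) y = contract v (G i y) *m B i y + B i y *m (contract v (G i y))^T.
Proof.
move=> pB iy; rewrite /along /contract mulmx_suml linear_sum mulmx_sumr -big_split.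
apply: eq_bigr => a _ /=.
have /eqP := pB i y iy a; rewrite -addrA -opprD subr_eq0 => /eqP ->.
by rewrite scalerDr scalemxAl linearZ scalemxAr.
Qed.

Lemma form_sym (B : 'M[R]_n) (u v : 'rV[R]_n) :
  B^T = B -> u *m B *m v^T = v *m B *m u^T.
Proof.
move=> sB; transitivity ((v *m B *m u^T)^T).
  by rewrite !trmx_mul trmxK sB mulmxA.
by apply/matrixP => r s; rewrite mxE !ord1.
Qed.

Lemma pairing_chart (g : bilin_field A) (X Y : vfield A) i j x :
  is_bilin_field g -> is_vfield X -> is_vfield Y ->
  dom (chart_of A i) x -> dom (chart_of A j) x ->
  pairing g X Y i (Defs.coord (chart_of A i) x) =
  pairing g X Y j (Defs.coord (chart_of A j) x).
Proof.
move=> [_ trg] [_ trX] [_ trY] ix jx; rewrite /pairing (trg i j x) //.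
by rewrite -(trX i j x) // -(trY i j x) // trmx_mul !mulmxA.
Qed.

(** Metric compatibility: the derivative of g(X, X) along d_a is 2 g(D_a X, X). The derivative of
    [g] supplies exactly the Christoffel terms that complete dX to DX. *)
Lemma gradient_pairing (g : bilin_field A) (D : connection A)
    (X : vfield A) i y :
  torsion_free D -> parallel_form D g -> img i y ->
  (g i y)^T = g i y ->
  mx_differentiable (X i) y -> mx_differentiable (g i) y ->
  gradient (pairing g X X i) y = 2 *: (X i y *m (cov_endo D X i y *m g i y)^T).
Proof.
move=> tD pD iy sg dX dg; rewrite (cov_endoE _ tD iy).
set x := X i y; set B := g i y.
set Dx := contract x (D i y).
set E := jac_mx (X i) y.
apply/rowP => a; rewrite mxE.
have sym u v := form_sym u v sg; rewrite -/B in sym *.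
have dXg : mx_differentiable (fun z => X i z *m g i z) y by exact: mxdiffM.
have pE : pd a (fun z => X i z *m g i z *m (X i z)^T) y =
          2 *: (row a ((E + Dx) *m B) *m x^T).
  rewrite pdM //; last exact: mxdiff_tr.
  rewrite pdM // pd_tr -/x.
  have /eqP := pD i y iy a; rewrite -addrA -opprD subr_eq0 => /eqP ->.
  have rE : row a (E + Dx) = pd a (X i) y + x *m D i y a.
    by rewrite linearD /= row_jac -(mulmx_contract _ _ (tD i y iy)).
  rewrite -/B row_mul rE.
  rewrite (sym x) mulmxDr !mulmxDl.
  rewrite (_ : x *m (B *m (D i y a)^T) *m x^T = x *m D i y a *m B *m x^T).
    by rewrite !mulmxA; mx_abel.
  by rewrite -[RHS]sym trmx_mul !mulmxA.
transitivity ((2 *: (row a ((E + Dx) *m B) *m x^T)) 0 0).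
  by rewrite -pE !mxE.
rewrite !mxE; congr (_ * _); apply: eq_bigr => b _.
by rewrite ![in LHS]mxE ![in RHS]mxE mulrC.
Qed.

(* A Killing field X satisfies g(D_X X, Y) = (L_X g)(X, Y) - Y(g(X, X)) / 2. *)
Lemma killing_acceleration (g : bilin_field A) (D : connection A)
    (X : vfield A) i y :
  torsion_free D -> parallel_form D g -> img i y ->
  (g i y)^T = g i y ->
  mx_differentiable (X i) y -> mx_differentiable (g i) y ->
  lie_form X g i y = 0 ->
  cov D X X i y *m g i y = - (2^-1 *: gradient (pairing g X X i) y).
Proof.
move=> tD pD iy sg dX dg L.
set x := X i y; set B := g i y.
set Dx := contract x (D i y).
set E := jac_mx (X i) y.
have covE : cov D X X i y = x *m (E + Dx).
  rewrite /cov mulmxDr -row_along_jac mulmx_sumr -big_split.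
  by apply: eq_bigr => a _ /=; rewrite scalerDr scalemxAr.
(* For a torsion-free metric connection, L_X g is the symmetrisation of g(DX, .), so the Killing
   equation says that DX is skew. *)
have lieE : E *m B + Dx *m B + (E *m B + Dx *m B)^T = 0.
  rewrite -[RHS]L /lie_form (along_parallel _ pD iy) -/B -/x -/Dx -/E.
  rewrite linearD /= !trmx_mul /= -/B sg -/B.
  by mx_abel.
have gradE := gradient_pairing tD pD iy sg dX dg.
rewrite (cov_endoE _ tD iy) -/E -/Dx -/x -/B in gradE.
rewrite gradE scalerA mulVf ?scale1r ?pnatr_eq0 // covE.
rewrite -mulmxA -mulmxN; congr (x *m _).
by apply/eqP; rewrite -addr_eq0; apply/eqP; rewrite -[RHS]lieE mulmxDl.
Qed.

End TensorCalculus.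

(** * Conical special Kahler manifolds *)

Section ConicalSpecialKahler.
Context {R : realType} {T : topologicalType} {n : nat} {M : manifold R T n}.
Variable S : conical_special_kahler M.
Variable i : Defs.index M.

Let J := csk_J S i.
Let g := csk_g S i.
Let G := csk_nabla S i.
Let xi := csk_xi S i.
Let w := fundamental_form (csk_g S) (csk_J S) i.
Let Z := apply_endo (csk_J S) (csk_xi S) i.

Lemma img_open : open (img i).
Proof. by have [] := manifold_chart i. Qed.

Variable q : 'rV[R]_n.
Hypothesis iq : img i q.

Lemma near_img : \forall z \near q, img i z.
Proof. exact: (near_open img_open iq (fun _ iz => iz)). Qed.

Lemma csk_J_smooth : smooth_mx_on (img i) J.
Proof. by have [_ [[]]] := csk_pseudo_kahler S. Qed.

Lemma csk_g_smooth : smooth_mx_on (img i) g.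
Proof. by have [[[]]] := csk_pseudo_kahler S. Qed.

Lemma csk_nabla_smooth a : smooth_mx_on (img i) (fun y => G y a).
Proof. by have [] := csk_connection S. Qed.

Lemma csk_xi_smooth : smooth_mx_on (img i) xi.
Proof. by have [] := csk_vfield S. Qed.

Lemma csk_g_sym : (g q)^T = g q.
Proof. by have [[_ /(_ _ _ iq)[]]] := csk_pseudo_kahler S. Qed.

Lemma csk_g_unit : g q \in unitmx.
Proof. by have [[_ /(_ _ _ iq)[]]] := csk_pseudo_kahler S. Qed.

Lemma csk_JJ : J q *m J q = - 1%:M.
Proof. by have [_ [_ /(_ _ _ iq)[]]] := csk_pseudo_kahler S. Qed.

Lemma csk_Jg : g q *m (J q)^T = - (J q *m g q).
Proof.
by have [_ _ /(_ _ _ iq)/eqP] := csk_pseudo_kahler S; rewrite addrC addr_eq0 => /eqP.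
Qed.

Lemma csk_J_unit : J q \in unitmx.
Proof.
apply: (proj1 (mulmx1_unit (B := - J q) _)).
by rewrite mulmxN csk_JJ opprK.
Qed.

Lemma csk_w_unit : w q \in unitmx.
Proof. by rewrite unitmx_mul csk_J_unit csk_g_unit. Qed.

Let dJ := smooth_mx_on_mxdiff csk_J_smooth iq.
Let dg := smooth_mx_on_mxdiff csk_g_smooth iq.
Let dxi := smooth_mx_on_mxdiff csk_xi_smooth iq.

Lemma csk_jac_xi : jac_mx xi q + contract (xi q) (G q) = 1%:M.
Proof.
by rewrite -(cov_endoE _ (csk_torsion_free S)) // csk_nabla_xi.
Qed.

(* nabla xi = D xi gives G(xi) = D(xi), so the nabla-parallel form w and the
   D-parallel metric g are transported alike along xi, and so is J. *)
Lemma along_xi_J :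
  along (xi q) J q = contract (xi q) (G q) *m J q - J q *m contract (xi q) (G q).
Proof.
have [_ tD pD] := csk_levi_civita S.
have DG : contract (xi q) (csk_D S i q) = contract (xi q) (G q).
  apply: (@addrI _ (jac_mx xi q)); rewrite csk_jac_xi.
  by rewrite -(cov_endoE _ tD) // csk_D_xi.
have gE := along_parallel (xi q) pD iq; rewrite -/(g) DG in gE.
have := along_parallel (xi q) (csk_parallel S) iq.
rewrite {1}/fundamental_form (alongM _ dJ dg) gE.
rewrite /fundamental_form -/J -/g -/G.
set E := contract _ _; rewrite mulmxDr !mulmxA.
(* After the product rule for [w = J g], the terms [J E g] and [J g E^T] occur on the left; removing
   them leaves an equation in which the invertible [g] can be cancelled. *)
move=> /(congr1 (fun X => X - (J q *m E *m g q + J q *m g q *m E^T))).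
rewrite addrK opprD addrA addrAC addrK -mulmxBl.
by move=> /(congr1 (mulmx^~ (invmx (g q)))); rewrite !mulmxK ?csk_g_unit.
Qed.

(** The covariant derivative nabla_a J; its row b is (nabla_a J) d_b. *)
Let C a := pd a J q + J q *m G q a - G q a *m J q.

(** Since nabla is torsion-free, d^nabla J is the antisymmetrisation of nabla J, so its vanishing
    makes nabla J symmetric. *)
Let rowC a b : row b (C a) = row a (C b).
Proof.
have /eqP := csk_d_nabla_J S iq a b; rewrite subr_eq0 !pd_row -/J -/G => /eqP E.
have tG := csk_torsion_free S iq a b; rewrite -/G in tG.
by rewrite /C !linearB !linearD /= !row_mul E tG.
Qed.

Let contractC v : contract v C =
  along v J q + J q *m contract v (G q) - contract v (G q) *m J q.
Proof.
rewrite /contract /C /along mulmx_sumr mulmx_suml -sumrN -!big_split.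
by apply: eq_bigr => a _ /=; rewrite -scalemxAr -scalemxAl scalerBr scalerDr.
Qed.

(** By symmetry (nabla_a J) xi = (nabla_xi J) d_a, and nabla_xi J = 0 by [along_xi_J]. *)
Let xiC a : xi q *m C a = 0.
Proof.
rewrite (mulmx_contract _ _ rowC) contractC along_xi_J.
by rewrite subrK subrr linear0.
Qed.

(** This is nabla Z = J: nabla_a (J xi) = (nabla_a J) xi + J (nabla_a xi), where the first term
    vanishes and nabla xi = Id. *)
Lemma csk_jac_Z : jac_mx Z q + contract (Z q) (G q) = J q.
Proof.
apply/row_matrixP => a; rewrite linearD /= row_jac.
rewrite -(mulmx_contract _ _ (csk_torsion_free S iq)) pdM // -/xi -/J -/G.
have := xiC a; rewrite /C mulmxBr mulmxDr => /eqP.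
rewrite subr_eq0 => /eqP E.
rewrite /Z /apply_endo -/xi -/J -addrA -(mulmxA (xi q)) E mulmxA -mulmxDl.
rewrite (mulmx_contract _ _ (csk_torsion_free S iq)) -row_jac -linearD /=.
by rewrite csk_jac_xi -row_mul mul1mx.
Qed.

(** Differentiating [J J = -1] gives the anticommutation of nabla J with J; the Christoffel terms
    cancel by the same identity. *)
Let JC a : C a *m J q = - (J q *m C a).
Proof.
have : pd a (fun y => J y *m J y) q = 0.
  rewrite -(pd_cst q a (- 1%:M : 'M[R]_n)); apply: near_eq_pd.
  apply: (near_open img_open iq) => z iz.
  by have [_ [_ /(_ _ _ iz)[]]] := csk_pseudo_kahler S.
rewrite pdM // => /eqP; rewrite addr_eq0 => /eqP E.
rewrite /C mulmxBl mulmxDl mulmxBr mulmxDr E -(mulmxA (G q a)) csk_JJ.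
rewrite (mulmxA (J q) (J q)) csk_JJ mulNmx mulmxN mul1mx mulmx1 !mulmxA.
by mx_abel.
Qed.

(** This is nabla_Z J = 0: by symmetry (nabla_Z J) d_a = (nabla_a J) J xi, which equals - J (nabla_a
    J) xi = 0. *)
Lemma along_Z_J :
  along (Z q) J q = contract (Z q) (G q) *m J q - J q *m contract (Z q) (G q).
Proof.
have : contract (Z q) C = 0.
  apply/row_matrixP => a; rewrite -(mulmx_contract _ _ rowC) linear0.
  rewrite /Z /apply_endo -mulmxA -/J.
  by rewrite -[J q *m C a]opprK -JC mulmxN mulmxA xiC mul0mx oppr0.
rewrite contractC => /eqP; rewrite subr_eq0 => /eqP <-.
by rewrite addrK.
Qed.

Lemma along_Z_w :
  along (Z q) w q = contract (Z q) (G q) *m w q + w q *m (contract (Z q) (G q))^T.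
Proof. exact: along_parallel (csk_parallel S) iq. Qed.

(** This is nabla_Z g = 0. In [w = J g] both [w] and [J] are nabla-parallel along Z, and [J] is
    invertible. *)
Lemma along_Z_g :
  along (Z q) g q = contract (Z q) (G q) *m g q + g q *m (contract (Z q) (G q))^T.
Proof.
have := along_Z_w; rewrite {1}/w {1}/fundamental_form (alongM _ dJ dg) along_Z_J.
rewrite /w /fundamental_form -/J -/g.
set E := contract _ _ => /(congr1 (fun X => X - (E *m J q - J q *m E) *m g q)).
rewrite [X in X = _]addrC addKr mulmxBl !mulmxA => H.
apply: (can_inj (mulKmx csk_J_unit)); rewrite H mulmxDr !mulmxA.
by mx_abel.
Qed.

(** Z is Killing on M: substituting dZ = J - G(Z), the Christoffel terms cancel against nabla_Z g =
    0 and the rest is the skewness of J. *)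
Lemma lie_Z_g :
  along (Z q) g q + jac_mx Z q *m g q + g q *m (jac_mx Z q)^T = 0.
Proof.
have -> : jac_mx Z q = J q - contract (Z q) (G q) by rewrite -csk_jac_Z addrK.
rewrite along_Z_g mulmxBl linearB /= mulmxBr csk_Jg.
by mx_abel.
Qed.

(** Here D xi = Id enters [gradient_pairing]; g(xi, xi) is thus a potential for 2 g(xi, .). *)
Lemma gradient_xi :
  gradient (pairing (csk_g S) (csk_xi S) (csk_xi S) i) q = 2 *: (xi q *m g q).
Proof.
have [_ tD pD] := csk_levi_civita S.
rewrite (gradient_pairing (X := csk_xi S) tD pD iq csk_g_sym dxi dg) csk_D_xi //.
by rewrite mul1mx csk_g_sym.
Qed.

(** J is an isometry, being skew with square -1. *)
Lemma pairing_Z :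
  pairing (csk_g S) (apply_endo (csk_J S) (csk_xi S))
    (apply_endo (csk_J S) (csk_xi S)) i q =
  pairing (csk_g S) (csk_xi S) (csk_xi S) i q.
Proof.
rewrite /pairing /apply_endo trmx_mul -/xi -/J -/g.
rewrite mulmxA -(mulmxA _ (g q)) csk_Jg mulmxN mulNmx mulmxA.
by rewrite -(mulmxA (xi q) (J q) (J q)) csk_JJ mulmxN mulmx1 !mulNmx opprK.
Qed.

Lemma pairing_Z_neq0 :
  pairing (csk_g S) (apply_endo (csk_J S) (csk_xi S))
    (apply_endo (csk_J S) (csk_xi S)) i q != 0.
Proof.
have [/row_freeP[B PB] def] := csk_definite S iq.
(* A zero second row would make the second diagonal entry of the identity [P *m B = 1], given by row
   freeness, vanish. *)
have Z0 : Z q != 0.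
  apply/eqP => Z0; have := PB; rewrite -/Z Z0 mul_col_mx mul0mx.
  move=> /matrixP/(_ (rshift 1 0) (rshift 1 0)).
  by rewrite col_mxEd !mxE eqxx => /eqP; rewrite eq_sym oner_eq0.
have ZP : (Z q <= col_mx (xi q) (Z q))%MS.
  by rewrite -addsmxE addsmxSr.
by case: def => /(_ _ ZP Z0) H; [rewrite gt_eqF | rewrite lt_eqF].
Qed.

End ConicalSpecialKahler.

Arguments img_open {R T n M} i.

(** * Cotangent charts *)

Section Transitions.
Context {R : realType} {T : topologicalType} {n : nat} (M : manifold R T n).
Implicit Types i j k : Defs.index M.

Local Notation coordM i := (Defs.coord (chart_of M i)).
Local Notation invM i := (inv_coord (chart_of M i)).
Local Notation domM i := (dom (chart_of M i)).

Lemma coordK i x : domM i x -> invM i (coordM i x) = x.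
Proof. by have [_ _ H _ _] := manifold_chart i => /H. Qed.

Lemma img_coord i x : domM i x -> img i (coordM i x).
Proof. by move=> ix; exists x. Qed.

Lemma transition_coord i j x : domM i x ->
  transition (chart_of M i) (chart_of M j) (coordM i x) = coordM j x.
Proof. by move=> ix; rewrite /transition /= coordK. Qed.

Lemma overlap_open i j : open (overlap (chart_of M i) (chart_of M j)).
Proof. by have [] := manifold_smooth i j. Qed.

Lemma transition_smooth i j :
  smooth_mx_on (overlap (chart_of M i) (chart_of M j))
               (transition (chart_of M i) (chart_of M j)).
Proof. by have [] := manifold_smooth i j. Qed.

Lemma overlap_coord i j x : domM i x -> domM j x ->
  overlap (chart_of M i) (chart_of M j) (coordM i x).
Proof. by move=> ix jx; exists x. Qed.

Lemma transition_mxdiff i j x : domM i x -> domM j x ->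
  mx_differentiable (transition (chart_of M i) (chart_of M j)) (coordM i x).
Proof.
move=> ix jx.
exact: (smooth_mx_on_mxdiff (@transition_smooth i j) (overlap_coord ix jx)).
Qed.

Lemma jac_mxdiff i j x : domM i x -> domM j x ->
  mx_differentiable (jac i j) (coordM i x).
Proof.
move=> ix jx; apply: smooth_mx_on_mxdiff (overlap_coord ix jx).
exact: smooth_mx_on_jac (@transition_smooth i j).
Qed.

(** The chain rule, applied to transition maps that compose as expected near the point, the overlap
    being open. *)
Lemma jac_cocycle i j k x : domM i x -> domM j x -> domM k x ->
  jac i j (coordM i x) *m jac j k (coordM j x) = jac i k (coordM i x).
Proof.
move=> ix jx kx; rewrite /jac -(transition_coord j ix) -jac_comp.
- apply/row_matrixP => a; rewrite !row_jac; apply: near_eq_pd.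
  apply: (near_open (@overlap_open i j)); first exact: overlap_coord.
  move=> z [x' [ix' jx'] <-].
  by rewrite /= (transition_coord j ix') !transition_coord.
- exact: transition_mxdiff.
- by rewrite transition_coord //; exact: transition_mxdiff.
Qed.

Lemma jac_self i x : domM i x -> jac i i (coordM i x) = 1%:M.
Proof.
move=> ix; rewrite -(jac_id (coordM i x)).
apply/row_matrixP => a; rewrite !row_jac; apply: near_eq_pd.
apply: (near_open (@overlap_open i i)); first exact: overlap_coord.
by move=> z [x' [ix' _] <-]; rewrite transition_coord.
Qed.

Lemma jac_inv i j x : domM i x -> domM j x ->
  jac i j (coordM i x) \in unitmx /\
  jac j i (coordM j x) = invmx (jac i j (coordM i x)).
Proof.
move=> ix jx.
have H : jac i j (coordM i x) *m jac j i (coordM j x) = 1%:M.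
  by rewrite jac_cocycle // jac_self.
have [U _] := mulmx1_unit H; split => //.
by rewrite -[LHS](mulKmx U) H mulmx1.
Qed.

Let N := cotangent M.

Lemma img_cotangent i w : img (A := N) i w <-> img i (lsubmx w).
Proof.
split=> [[[x l] /= ix <-]|[x ix xw]]; first by rewrite row_mxKl; exact: img_coord.
set k := chart_at M x.
have kx : domM k x := manifold_cover M x.
(* The fibre components in chart [i] are converted to the preferred chart [k], in which elements of
   the fibre are named. *)
exists (x, rsubmx w *m (jac k i (coordM k x))^T) => //=.
rewrite -[RHS]hsubmxK -xw; congr row_mx.
by rewrite -mulmxA -trmx_mul jac_cocycle // jac_self // trmx1 mulmx1.
Qed.

Lemma cotangent_coordK i w : img i (lsubmx w) ->
  Defs.coord (chart_of N i) (inv_coord (chart_of N i) w) = w.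
Proof.
move=> [x ix xw]; rewrite /= -xw coordK //.
have kx : domM (chart_at M x) x := manifold_cover M x.
rewrite -[RHS]hsubmxK -xw; congr row_mx.
by rewrite -mulmxA -trmx_mul jac_cocycle // jac_self // trmx1 mulmx1.
Qed.

(** The detour through the preferred chart disappears by the cocycle rule, leaving the inverse
    transpose of the base Jacobian. *)
Lemma cotangent_transition i j w :
  overlap (chart_of M i) (chart_of M j) (lsubmx w) ->
  transition (chart_of N i) (chart_of N j) w =
  row_mx (transition (chart_of M i) (chart_of M j) (lsubmx w))
         (rsubmx w *m (invmx (jac i j (lsubmx w)))^T).
Proof.
move=> [x [ix jx] xw]; rewrite /transition /= -xw coordK //; congr row_mx.
have kx : domM (chart_at M x) x := manifold_cover M x.
by rewrite -mulmxA -trmx_mul jac_cocycle // (jac_inv ix jx).2.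
Qed.

(** The transition is linear in [p] with coefficients depending on [q]. Differentiating these
    coefficients gives the upper right block; the new base coordinates do not depend on [p]. *)
Lemma cotangent_jac i j w (q := lsubmx w) :
  overlap (chart_of M i) (chart_of M j) q ->
  jac (A := N) i j w =
  block_mx (jac i j q)
    (\matrix_a (rsubmx w *m (pd a (fun z => invmx (jac i j z)) q)^T))
    0 (invmx (jac i j q))^T.
Proof.
move=> oq; have [x [ix jx] xq] := oq.
have dH : mx_differentiable (fun z => invmx (jac i j z)) q.
  apply: mxdiff_inv; last by rewrite -xq; exact: jac_mxdiff.
  apply: (near_open (@overlap_open i j) oq) => z [x' [ix' jx'] <-].
  exact: (jac_inv ix' jx').1.
have dHw : mx_differentiable
    (fun z : 'rV[R]_(n + n) => (invmx (jac i j (lsubmx z)))^T) w.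
  exact/mxdiff_tr/(mxdiff_lsubmx dH).
apply/row_matrixP => a; rewrite row_jac.
have co : open ((lsubmx : 'rV[R]_(n + n) -> 'rV[R]_n) @^-1`
                overlap (chart_of M i) (chart_of M j)).
  by apply: open_comp (@overlap_open i j) => z _; exact: continuous_lsubmx.
rewrite (near_eq_pd a (near_open co oq (@cotangent_transition i j))).
rewrite pd_row_mx pdM //; last exact: mxdiff_rsubmx_id.
rewrite block_mxEv -[a]splitK; case: (fintype.split a) => b /=.
- rewrite rowKu row_row_mx pd_lshift pd_lshift_rsubmx mul0mx add0r.
  by rewrite row_jac rowK pd_tr (pd_lshift b (fun z => invmx (jac i j z))).
- rewrite rowKd row_row_mx pd_rshift pd_rshift_rsubmx pd_tr.
  rewrite (pd_rshift b (fun z => invmx (jac i j z))) trmx0 mulmx0 addr0.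
  by rewrite row0 -rowE.
Qed.

End Transitions.

(** * Lie derivatives in a moving frame *)

Section Frames.
Context {R : realType}.

(* Here P is a moving frame and the hypothesis says that K is the Lie
   derivative of the frame, expressed in the frame. *)
Lemma lie_form_frame n (v : 'rV[R]_n) (P B : 'rV[R]_n -> 'M[R]_n)
    (E K : 'M[R]_n) y :
  mx_differentiable P y -> mx_differentiable B y ->
  along v P y + E *m P y = P y *m K ->
  along v (fun z => P z *m B z *m (P z)^T) y
    + E *m (P y *m B y *m (P y)^T) + (P y *m B y *m (P y)^T) *m E^T =
  P y *m (along v B y + K *m B y + B y *m K^T) *m (P y)^T.
Proof.
move=> dP dB /(canRL (addrK _)) aP.
rewrite alongM; [|exact: mxdiffM|exact: mxdiff_tr].
rewrite alongM // along_tr aP linearB /= !trmx_mul.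
rewrite !(mulmxDl, mulmxDr, mulmxN, mulNmx, mulmxA).
by mx_abel.
Qed.

(** The derivative of [invmx P] contributes the term [- B *m K] and cancels the final product with
    [E]. *)
Lemma lie_endo_frame n (v : 'rV[R]_n) (P B : 'rV[R]_n -> 'M[R]_n)
    (E K : 'M[R]_n) y :
  mx_differentiable P y -> mx_differentiable B y ->
  (\forall z \near y, P z \in unitmx) ->
  along v P y + E *m P y = P y *m K ->
  along v (fun z => P z *m B z *m invmx (P z)) y
    + E *m (P y *m B y *m invmx (P y)) - (P y *m B y *m invmx (P y)) *m E =
  P y *m (along v B y + K *m B y - B y *m K) *m invmx (P y).
Proof.
move=> dP dB uP /(canRL (addrK _)) aP; have uPy := nbhs_singleton uP.
rewrite alongM; [|exact: mxdiffM|exact: mxdiff_inv].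
rewrite alongM // along_inv // aP.
rewrite !(mulmxDl, mulmxDr, mulmxN, mulNmx, mulmxA).
rewrite mulmxKV //.
have -> : P y *m B y *m invmx (P y) *m E *m P y *m invmx (P y) =
          P y *m B y *m invmx (P y) *m E by rewrite mulmxK.
by mx_abel.
Qed.

End Frames.

(** * The horizontal-vertical frame *)

Section CotangentFrame.
Context {R : realType} {T : topologicalType} {n : nat} {M : manifold R T n}.
Variable S : conical_special_kahler M.
Variable i : Defs.index M.

Let G := csk_nabla S i.

(** The fibre components of horizontal vectors: the horizontal lift of [dq] at (q, p) has
    [dp = dq *m Gam]. *)
Definition christoffel_contraction (w : 'rV[R]_(n + n)) : 'M[R]_n :=
  \matrix_(a < n, b < n) (csk_nabla S i (lsubmx w) a *m (rsubmx w)^T) b 0.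

Local Notation Gam := christoffel_contraction.

Lemma splittingE w :
  splitting S i w = block_mx 1%:M (- Gam w) 0 1%:M.
Proof. by []. Qed.

Lemma row_christoffel a w : row a (Gam w) = rsubmx w *m (G (lsubmx w) a)^T.
Proof.
apply: trmx_inj; rewrite trmx_mul trmxK.
by apply/matrixP => b c; rewrite !ord1 [LHS]mxE [LHS]mxE [LHS]mxE.
Qed.

Lemma splitting_unit w : splitting S i w \in unitmx.
Proof.
apply: (proj1 (mulmx1_unit (B := block_mx 1%:M (Gam w) 0 1%:M) _)).
rewrite splittingE mulmx_block !mul1mx !mulmx1 !mul0mx !mulmx0 !addr0 add0r.
by rewrite subrr -scalar_mx_block.
Qed.

Variable w : 'rV[R]_(n + n).
Let q := lsubmx w.
Let p := rsubmx w.
Hypothesis iq : img i q.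

Let dG a := smooth_mx_on_mxdiff (csk_nabla_smooth S i a) iq.

Let dGw a : mx_differentiable
  (fun z : 'rV[R]_(n + n) => (G (lsubmx z) a)^T) w.
Proof. exact/mxdiff_tr/(mxdiff_lsubmx (dG a)). Qed.

Lemma christoffel_mxdiff : mx_differentiable Gam w.
Proof.
apply: mxdiff_rows => a.
rewrite (_ : (fun z => _) = fun z => rsubmx z *m (G (lsubmx z) a)^T).
  by apply: mxdiffM (dGw a); exact: mxdiff_rsubmx_id.
by apply/funext => z; rewrite row_christoffel.
Qed.

Lemma splitting_mxdiff : mx_differentiable (splitting S i) w.
Proof.
apply: mxdiff_block_mx; try exact: mxdiff_cst.
exact/mxdiffN/christoffel_mxdiff.
Qed.

Lemma row_pd_christoffel a b : row a (pd b Gam w) =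
  pd b (fun z => rsubmx z) w *m (G q a)^T
  + p *m (pd b (fun z => G (lsubmx z) a) w)^T.
Proof.
transitivity (pd b (fun z => rsubmx z *m (G (lsubmx z) a)^T) w).
  rewrite -pd_row; apply: near_eq_pd; apply: filterE => z.
  exact: row_christoffel.
by rewrite pdM ?pd_tr //; exact: mxdiff_rsubmx_id.
Qed.

Lemma mulmx_christoffel z : z *m Gam w = p *m (contract z (G q))^T.
Proof.
rewrite mulmx_sum_row /contract linear_sum mulmx_sumr.
by apply: eq_bigr => a _; rewrite row_christoffel linearZ -scalemxAr.
Qed.

Variable Z : 'rV[R]_n -> 'rV[R]_n.
Hypothesis dZ : mx_differentiable Z q.

Definition horizontal_lift (w : 'rV[R]_(n + n)) : 'rV[R]_(n + n) :=
  row_mx (Z (lsubmx w)) (Z (lsubmx w) *m Gam w).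

Lemma horizontal_lift_splitting z :
  horizontal_lift z *m splitting S i z = row_mx (Z (lsubmx z)) 0.
Proof.
rewrite splittingE mul_row_block !mulmx1 mulmx0 addr0 mulmxN.
by rewrite addNr.
Qed.

(** Product rule for [Z *m Gam]. In the fibre directions only [p] varies, and [Z *m Gam] is linear
    in [p] with matrix G(Z)^T. *)
Lemma jac_horizontal_lift :
  jac_mx horizontal_lift w =
  block_mx (jac_mx Z q)
    (jac_mx Z q *m Gam w +
     \matrix_a (p *m (contract (Z q) (fun c => pd a (fun y => G y c) q))^T))
    0 (contract (Z q) (G q))^T.
Proof.
have dZw : mx_differentiable (fun z : 'rV[R]_(n + n) => Z (lsubmx z)) w.
  exact: mxdiff_lsubmx.
apply/row_matrixP => a; rewrite row_jac pd_row_mx.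
rewrite pdM //; last exact: christoffel_mxdiff.
rewrite block_mxEv -[a]splitK; case: (fintype.split a) => b /=.
- rewrite rowKu row_row_mx pd_lshift row_jac linearD /= row_mul row_jac rowK.
  congr (row_mx _ (_ + _)).
  rewrite mulmx_sum_row /contract linear_sum mulmx_sumr.
  apply: eq_bigr => c _; rewrite row_pd_christoffel pd_lshift_rsubmx mul0mx add0r.
  by rewrite (pd_lshift b (fun y => G y c)) linearZ -scalemxAr.
- rewrite rowKd row_row_mx pd_rshift row0 mul0mx add0r; congr row_mx.
  rewrite mulmx_sum_row /contract !linear_sum.
  apply: eq_bigr => c _; rewrite row_pd_christoffel pd_rshift_rsubmx.
  rewrite (pd_rshift b (fun y => G y c)) trmx0 mulmx0 addr0 -rowE.
  by rewrite !linearZ.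
Qed.

(** The base part of [v] differentiates the Christoffel symbols, its fibre part differentiates
    [p]. *)
Lemma row_along_christoffel v a :
  row a (along v Gam w) =
  p *m (along (lsubmx v) (fun y => G y a) q)^T + rsubmx v *m (G q a)^T.
Proof.
rewrite /along linear_sum big_split_ord /=; congr (_ + _).
  rewrite linear_sum mulmx_sumr; apply: eq_bigr => c _.
  rewrite linearZ /= row_pd_christoffel pd_lshift_rsubmx mul0mx add0r.
  by rewrite (pd_lshift c (fun y => G y a)) !linearZ /= mxE.
rewrite [RHS]mulmx_sum_row; apply: eq_bigr => c _.
rewrite linearZ /= row_pd_christoffel pd_rshift_rsubmx.
by rewrite (pd_rshift c (fun y => G y a)) trmx0 mulmx0 addr0 -rowE mxE.
Qed.

(* The off-diagonal block vanishes because nabla is flat. *)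
Lemma lie_splitting :
  along (horizontal_lift w) (splitting S i) w
    + jac_mx horizontal_lift w *m splitting S i w =
  splitting S i w *m block_mx (jac_mx Z q) 0 0 (contract (Z q) (G q))^T.
Proof.
rewrite {1}/splitting along_block_mx !along_cst alongN; last exact: christoffel_mxdiff.
rewrite jac_horizontal_lift splittingE !mulmx_block add_block_mx.
rewrite !(mul1mx, mulmx1, mul0mx, mulmx0, addr0, add0r); congr block_mx.
rewrite mulmxN addKr; apply/row_matrixP => a.
rewrite linearD /= linearN /= row_along_christoffel rowK mulNmx linearN /= row_mul.
rewrite row_christoffel row_mxKl row_mxKr mulmx_christoffel -/q -/p.
set C0 := contract _ _; set C1 := contract _ _; set C2 := along _ _ _.
(* Flatness summed against the components of Z: it trades the derivative of the symbols along d_a,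
   contracted with Z, for the derivative of [G_a] along Z, up to a commutator. *)
have C1E : C1 = C2 + G q a *m C0 - C0 *m G q a.
  apply/eqP; rewrite -subr_eq0; apply/eqP.
  transitivity (contract (Z q) (fun c => pd a (fun y => G y c) q
    - pd c (fun y => G y a) q + G q c *m G q a - G q a *m G q c)); last first.
    by rewrite /contract big1 // => c _; rewrite csk_flat // scaler0.
  rewrite /C1 /C2 /C0 /along /contract mulmx_sumr mulmx_suml.
  rewrite opprB opprD -!sumrN -!big_split /=; apply: eq_bigr => c _.
  rewrite -scalemxAl -scalemxAr.
  by mx_abel.
have -> : C1^T = C2^T + C0^T *m (G q a)^T - (G q a)^T *m C0^T.
  by rewrite C1E linearB linearD /= !trmx_mul.
rewrite mulmxBr mulmxDr !mulmxA.
by mx_abel.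
Qed.

End CotangentFrame.

Lemma img_cotangentE (R : realType) (T : topologicalType) n (M : manifold R T n)
    (i : Defs.index M) :
  img (A := cotangent M) i =
  (lsubmx : 'rV[R]_(n + n) -> 'rV[R]_n) @^-1` img (A := M) i.
Proof. by apply/seteqP; split=> w /img_cotangent. Qed.

Lemma img_cotangent_open (R : realType) (T : topologicalType) n
    (M : manifold R T n) (i : Defs.index M) : open (img (A := cotangent M) i).
Proof.
rewrite img_cotangentE.
by apply: open_comp (img_open i) => z _; exact: continuous_lsubmx.
Qed.

(** * The extension of Z as a horizontal lift *)

Section Extension.
Context {R : realType} {T : topologicalType} {n : nat} {M : manifold R T n}.
Variable S : conical_special_kahler M.

Let N := cotangent M.
Let Zv := apply_endo (csk_J S) (csk_xi S).

Lemma apply_endo_jac i j x :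
  dom (chart_of M i) x -> dom (chart_of M j) x ->
  Zv i (Defs.coord (chart_of M i) x) *m jac i j (Defs.coord (chart_of M i) x) =
  Zv j (Defs.coord (chart_of M j) x).
Proof.
move=> ix jx; have [_ [[_ trJ] _] _ _] := csk_pseudo_kahler S.
have [_ trxi] := csk_vfield S.
by rewrite /Zv /apply_endo -mulmxA trJ // mulmxA trxi.
Qed.

(* In an affine chart the flat connection on T^*M is trivial, so Z_N is the
   horizontal lift of Z; this description makes sense in every chart. *)
Lemma cmap_extension_lift (ZN : vfield N) i (w : 'rV[R]_(n + n)) :
  is_cmap_extension S Zv ZN -> img i (lsubmx w) ->
  ZN i w = horizontal_lift S i (Zv i) w.
Proof.
move=> [[_ trZN] aff] [x ix xw].
have [j [affj jx ZNj]] := aff x.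
set u := inv_coord (chart_of N i) w.
have u1 : u.1 = x by rewrite /u /= -xw coordK.
have iw : img i (lsubmx w) by exists x.
have cu : Defs.coord (chart_of N i) u = w by exact: cotangent_coordK.
have iu : dom (chart_of N i) u.
  by change (dom (chart_of M i) u.1); rewrite u1.
have ju : dom (chart_of N j) u.
  by change (dom (chart_of M j) u.1); rewrite u1.
have jN : img (A := N) j (Defs.coord (chart_of N j) u) by exists u.
have oq : overlap (chart_of M i) (chart_of M j) (lsubmx w).
  by rewrite -xw; exact: overlap_coord.
have := trZN i j u iu ju; rewrite cu ZNj // [lsubmx _]row_mxKl u1 -(apply_endo_jac ix jx).
rewrite xw cotangent_jac // -[ZN i w]hsubmxK mul_row_block mulmx0 addr0.
set q := lsubmx w in xw oq *; set p := rsubmx w.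
set X := lsubmx (ZN i w); set V := rsubmx (ZN i w); set B := \matrix_a _.
have [uJ _] := jac_inv ix jx; rewrite xw in uJ.
have dJ : mx_differentiable (jac i j) q by rewrite -xw; exact: jac_mxdiff.
move=> /eq_row_mx[XE VE].
have {}XE : X = Zv i q by apply: (can_inj (mulmxK uJ)).
rewrite /horizontal_lift -/q -XE; congr row_mx.
(* The fibre part of [Z_N] vanishes in the affine chart [j], so the transformation law reads
   [X *m B + V *m (invmx jac)^T = 0] and determines [V]. *)
have {}VE : V = - (X *m B *m (jac i j q)^T).
  move/eqP: VE; rewrite addrC addr_eq0 => /eqP VE.
  rewrite -mulNmx -VE -mulmxA -trmx_mul mulmxV // trmx1 mulmx1 //.
rewrite VE -mulmxA -mulmxN; congr (_ *m _).
apply/row_matrixP => a; rewrite row_christoffel linearN /= row_mul rowK -/q -/p.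
rewrite -mulmxA -trmx_mul pd_inv //; last first.
  apply: (near_open (@overlap_open _ _ _ M i j) oq) => z [x' [ix' jx'] <-].
  exact: (jac_inv ix' jx').1.
rewrite mulmxN !mulmxA mulmxV // mul1mx linearN /= mulmxN opprK.
congr (_ *m _^T).
(* The symbols of nabla vanish in chart [j], so those in chart [i] are purely the inhomogeneous term
   of the transformation law: [G_a *m jac = pd a jac]. *)
have [_ trG] := csk_connection S.
have := trG i j x ix jx a; rewrite xw.
have -> : \sum_(b < n) jac i j q a b *: csk_nabla S j (Defs.coord (chart_of M j) x) b = 0.
  by rewrite big1 // => b _; rewrite affj ?scaler0 //; exact: img_coord.
by rewrite mulmx0 addr0 => <-; rewrite mulmxK.
Qed.

End Extension.

(** * The horizontal lift of J xi *)

Section Proposition.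
Context {R : realType} {T : topologicalType} {n : nat} {M : manifold R T n}.
Variable S : conical_special_kahler M.

Let N := cotangent M.
Let Zv := apply_endo (csk_J S) (csk_xi S).

Variable i : Defs.index M.
Variable w : 'rV[R]_(n + n).
Let q := lsubmx w.
Hypothesis iq : img i q.

Let J := csk_J S i.
Let g := csk_g S i.
Let om := fundamental_form (csk_g S) (csk_J S) i.
Let G := csk_nabla S i.
Let P := splitting S i.
Let ZL := horizontal_lift S i (Zv i).
Let Bg y := block_mx (g y) 0 0 (invmx (g y)).

Lemma csk_Z_mxdiff : mx_differentiable (Zv i) q.
Proof.
apply: mxdiffM.
  exact: smooth_mx_on_mxdiff (@csk_xi_smooth _ _ _ _ S i) iq.
exact: smooth_mx_on_mxdiff (@csk_J_smooth _ _ _ _ S i) iq.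
Qed.

Let dg := smooth_mx_on_mxdiff (@csk_g_smooth _ _ _ _ S i) iq.
Let dJ := smooth_mx_on_mxdiff (@csk_J_smooth _ _ _ _ S i) iq.

Let ug : \forall z \near q, g z \in unitmx.
Proof. by apply: filterS (near_img iq) => z iz; exact: csk_g_unit. Qed.

Let dBg : mx_differentiable Bg q.
Proof.
apply: mxdiff_block_mx; try exact: mxdiff_cst; first exact: dg.
exact: mxdiff_inv.
Qed.

Lemma cmap_g_mxdiff : mx_differentiable (cmap_g S i) w.
Proof.
apply: mxdiffM; last exact/mxdiff_tr/splitting_mxdiff.
apply: mxdiffM; first exact: splitting_mxdiff.
exact: (mxdiff_lsubmx dBg).
Qed.

Lemma cmap_g_sym : (cmap_g S i w)^T = cmap_g S i w.
Proof.
rewrite /cmap_g !trmx_mul trmxK mulmxA tr_block_mx !trmx0 trmx_inv.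
by rewrite csk_g_sym.
Qed.

Lemma cmap_g_unit : cmap_g S i w \in unitmx.
Proof.
rewrite /cmap_g !unitmx_mul unitmx_tr splitting_unit andbT /=.
apply: (proj1 (mulmx1_unit (B := block_mx (invmx (g q)) 0 0 (g q)) _)).
rewrite mulmx_block !mul0mx !mulmx0 !addr0 add0r mulmxV ?mulVmx ?csk_g_unit //.
by rewrite -scalar_mx_block.
Qed.

(** In the frame, the horizontal block is L_Z g = 0 and the vertical one is nabla_Z g^-1 = 0, the
    latter by differentiating the inverse of [g]. *)
Lemma lift_killing :
  along (ZL w) (cmap_g S i) w + jac_mx ZL w *m cmap_g S i w
    + cmap_g S i w *m (jac_mx ZL w)^T = 0.
Proof.
rewrite (lie_form_frame (splitting_mxdiff S iq) (mxdiff_lsubmx dBg)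
  (lie_splitting S iq csk_Z_mxdiff)).
rewrite (_ : along _ _ w + _ + _ = 0) ?mulmx0 ?mul0mx //.
rewrite (along_lsubmx Bg) row_mxKl -/q along_block_mx !along_cst.
rewrite tr_block_mx !trmx0 trmxK !mulmx_block !(mul0mx, mulmx0, addr0, add0r).
rewrite !add_block_mx !addr0 (lie_Z_g S iq) along_inv // (along_Z_g S iq).
rewrite -/g -/G -/(Zv i q); set C := contract _ _.
rewrite mulmxDr mulmxDl (mulmxA _ (g q) (C^T)) mulVmx ?csk_g_unit // mul1mx.
rewrite -!mulmxA mulmxV ?csk_g_unit // mulmx1.
rewrite (_ : - _ + _ + _ = 0); last by mx_abel.
by rewrite -[RHS]block_mx0.
Qed.

(** In the frame the Lie derivative acts through dZ = J - G(Z) and G(Z)^T. All terms in G(Z) cancel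
    since nabla_Z omega = 0; what remains comes from nabla Z = J and is - J_3, by skewness of J. *)
Lemma lift_lie_J2 :
  along (ZL w) (cmap_J2 S i) w + jac_mx ZL w *m cmap_J2 S i w
    - cmap_J2 S i w *m jac_mx ZL w = - cmap_J3 S i w.
Proof.
pose B2 y : 'M[R]_(n + n) := block_mx 0 (om y) (- invmx (om y)) 0.
have uom : \forall z \near q, om z \in unitmx.
  by apply: filterS (near_img iq) => z iz; exact: csk_w_unit.
have dom' : mx_differentiable om q by exact: mxdiffM dJ dg.
have dB2 : mx_differentiable B2 q.
  apply: mxdiff_block_mx; try exact: mxdiff_cst; first exact: dom'.
  exact/mxdiffN/mxdiff_inv.
rewrite (lie_endo_frame (splitting_mxdiff S iq) (mxdiff_lsubmx dB2) _
  (lie_splitting S iq csk_Z_mxdiff)); last first.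
  by apply: filterE => z; exact: splitting_unit.
rewrite /cmap_J3 /cmap_J2 /cmap_J1 /cmap_endo -/P !mulmxA.
rewrite mulmxKV ?splitting_unit // -[in RHS](mulmxA (P w)) -[RHS]mulNmx -[in RHS]mulmxN.
congr (_ *m _ *m _).
rewrite (along_lsubmx B2) row_mxKl -/q -/om along_block_mx !along_cst alongN; last first.
  exact: mxdiff_inv.
rewrite along_inv // (along_Z_w S iq) -/om -/G -/(Zv i q) /B2; set C := contract _ _.
have jZ : jac_mx (Zv i) q = J q - C by rewrite /J -(csk_jac_Z S iq) addrK.
have uo := nbhs_singleton uom.
rewrite !mulmx_block !(mul0mx, mulmx0, addr0, add0r) !opp_block_mx !add_block_mx.
rewrite !oppr0 !addr0; congr block_mx; rewrite jZ.
- rewrite mulmxBl /om /fundamental_form -/J -/g -(mulmxA (J q) (g q) (J q)^T).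
  by rewrite (csk_Jg S iq) mulmxN opprK !mulmxA; mx_abel.
- rewrite opprK mulmxDr mulmxDl (mulmxA _ (om q) (C^T)) mulVmx // mul1mx.
  rewrite -(mulmxA _ (C *m om q)) mulmxK // !mulNmx mulmxN mulmxBr !opprK.
  by mx_abel.
Qed.

(** J_1 Z_N is the horizontal lift of J Z = - xi, and g_N turns a horizontal lift into a covector
    pulled back from M. *)
Lemma lift_J1_g : ZL w *m cmap_J1 S i w *m cmap_g S i w =
  row_mx (- (csk_xi S i q *m g q)) 0.
Proof.
rewrite /cmap_J1 /cmap_endo /cmap_g -/P !mulmxA mulmxKV ?splitting_unit //.
rewrite (horizontal_lift_splitting S i (Zv i)) !mul_row_block.
rewrite !(mul0mx, mulmx0, addr0, add0r) /P splittingE tr_block_mx mul_row_block.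
rewrite !trmx1 !trmx0 !(mul0mx, mulmx0, addr0, add0r, mulmx1).
by rewrite /Zv /apply_endo -(mulmxA (csk_xi S i q)) csk_JJ // mulmxN mulmx1 mulNmx.
Qed.

(** Horizontal lifting preserves lengths, and Z has the same length as xi. *)
Lemma lift_pairing :
  (ZL w *m cmap_g S i w *m (ZL w)^T) 0 0 =
  pairing (csk_g S) (csk_xi S) (csk_xi S) i q.
Proof.
rewrite -(pairing_Z S iq) /cmap_g.
have -> B : ZL w *m (P w *m B *m (P w)^T) *m (ZL w)^T =
            (ZL w *m P w) *m B *m (ZL w *m P w)^T by rewrite trmx_mul !mulmxA.
rewrite (horizontal_lift_splitting S i (Zv i)) mul_row_block tr_row_mx mul_row_col.
by rewrite !(mul0mx, mulmx0, addr0, add0r).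
Qed.

End Proposition.

(** * From the horizontal lift to the extension, chart by chart *)

Theorem proposition2 (R : realType) (T : topologicalType) (n : nat)
    (M : manifold R T n) (S : conical_special_kahler M)
    (ZN : vfield (cotangent M)) :
  is_cmap_extension S (apply_endo (csk_J S) (csk_xi S)) ZN ->
  [/\ timelike_or_spacelike (cmap_g S) ZN,
      is_killing (cmap_g S) ZN,
      is_hamiltonian (fundamental_form (cmap_g S) (cmap_J1 S)) ZN,
      (forall D : connection (cotangent M), is_levi_civita (cmap_g S) D ->
         in_charts (fun i w =>
           cov D ZN ZN i w = apply_endo (cmap_J1 S) ZN i w)) &
      in_charts (fun i w => lie_endo ZN (cmap_J2 S) i w = - cmap_J3 S i w)].
Proof.
move=> ext; have vZN : is_vfield ZN by case: ext.
pose Zv := apply_endo (csk_J S) (csk_xi S).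
pose h i y := pairing (csk_g S) (csk_xi S) (csk_xi S) i y.
have lift i w : img (A := cotangent M) i w -> ZN i w = horizontal_lift S i (Zv i) w.
  by move=> /img_cotangent iq; exact: cmap_extension_lift.
have imgN_open i := img_cotangent_open (M := M) i.
(* Agreement near [w], not just at [w], is what allows [Z_N] to be replaced by the lift under
   derivatives. *)
have near_lift i w : img (A := cotangent M) i w ->
    \forall z \near w, ZN i z = horizontal_lift S i (Zv i) z.
  by move=> iw; exact: (near_open (imgN_open i) iw (lift i)).
have pairE i w : img (A := cotangent M) i w ->
    pairing (cmap_g S) ZN ZN i w = h i (lsubmx w).
  by move=> iw; rewrite /pairing lift // lift_pairing //; exact/img_cotangent.
have gradE i w : img (A := cotangent M) i w ->
    gradient (fun z => h i (lsubmx z)) w =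
    2 *: row_mx (csk_xi S i (lsubmx w) *m csk_g S i (lsubmx w)) 0.
  move=> /img_cotangent iq.
  by rewrite gradient_lsubmx gradient_xi // scale_row_mx scaler0.
have alongN i w p1 q1 (F : 'rV[R]_(n + n) -> 'M[R]_(p1, q1)) :
    img (A := cotangent M) i w ->
    along (ZN i w) F w = along (horizontal_lift S i (Zv i) w) F w.
  by move=> iw; rewrite lift.
have jacE i w : img (A := cotangent M) i w ->
    jac_mx (ZN i) w = jac_mx (horizontal_lift S i (Zv i)) w.
  move=> iw; apply/row_matrixP => a; rewrite !row_jac.
  by apply: near_eq_pd; exact: near_lift.
have killing i w : img (A := cotangent M) i w -> lie_form ZN (cmap_g S) i w = 0.
  move=> iw; rewrite /lie_form alongN // jacE //.
  by apply: lift_killing; exact/img_cotangent.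
(* omega_1(Z_N, .) is -1/2 times the differential of the pullback of g(xi, xi). This gives both the
   Hamiltonian and, through [killing_acceleration], the acceleration. *)
have J1E i w : img (A := cotangent M) i w ->
    ZN i w *m cmap_J1 S i w *m cmap_g S i w =
    - (2^-1 *: gradient (fun z => h i (lsubmx z)) w).
  move=> iw; rewrite gradE // scalerA mulVf ?pnatr_eq0 // scale1r.
  rewrite lift // lift_J1_g ?opp_row_mx ?oppr0 //; exact/img_cotangent.
split.
- move=> i w iw; rewrite pairE // /h -pairing_Z; last exact/img_cotangent.
  by apply: pairing_Z_neq0; exact/img_cotangent.
- by split.
(* The Hamiltonian must be one function on all of N, so it is evaluated in the preferred chart of
   the base point; [pairing_chart] gives the same value in every other chart. *)
- pose k (u : @cotangent_point R T n) := chart_at M u.1.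
  pose f (u : @cotangent_point R T n) :=
    - 2^-1 * h (k u) (Defs.coord (chart_of M (k u)) u.1).
  have fE i w : img (A := cotangent M) i w ->
      - 2^-1 * h i (lsubmx w) = (f \o inv_coord (chart_of (cotangent M) i)) w.
    move=> /img_cotangent [x ix xw]; rewrite /f /= -xw coordK //; congr (_ * _).
    have vxi := csk_vfield S; have [[gb _] _ _ _] := csk_pseudo_kahler S.
    by apply: pairing_chart => //; exact: manifold_cover.
  have hsm i : smooth_on (img (A := cotangent M) i) (fun w => h i (lsubmx w)).
    rewrite img_cotangentE; apply: (@smooth_on_lsubmx _ _ _ _ (h i)).
    have sxi := @csk_xi_smooth _ _ _ _ S i.
    have sg := @csk_g_smooth _ _ _ _ S i.
    have imo := img_open (M := M) i.
    exact: (smooth_mx_onM imo (smooth_mx_onM imo sxi sg) (smooth_mx_on_tr sxi)).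
  exists f; split=> i.
    apply: (eq_smooth_on (imgN_open i) (fE i)).
    apply: (smooth_onM (f := fun _ => - 2^-1) (imgN_open i) _ (hsm i)).
    exact: smooth_on_cst.
  move=> w iw; rewrite /fundamental_form mulmxA J1E //.
  apply/rowP => a; rewrite !mxE.
  rewrite -(near_eq_derive _ (near_open (imgN_open i) iw (fE i))).
  rewrite derive_mul ?derive_cst ?mul0r ?add0r ?mulNr //.
  exact: smooth_on_differentiable (hsm i) iw.
- move=> D [_ tD pD] i w iw.
  have iq : img (A := M) i (lsubmx w) by exact/img_cotangent.
  have ug := cmap_g_unit S iq.
  (* As g_N is nondegenerate, both sides may be compared after lowering the index; each becomes -1/2
     times the differential of g_N(Z_N, Z_N). *)
  apply: (can_inj (mulmxK ug)); rewrite /apply_endo J1E //.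
  rewrite (killing_acceleration tD pD iw (cmap_g_sym S iq) _ (cmap_g_mxdiff S iq)).
  + congr (- (_ *: _)); apply/rowP => a; rewrite !mxE.
    by apply: near_eq_derive; exact: (near_open (imgN_open i) iw (pairE i)).
  + by case: vZN => sZN _; apply: smooth_mx_on_mxdiff (sZN i) iw.
  + exact: killing.
- move=> i w iw; rewrite /lie_endo alongN // jacE //.
  by apply: lift_lie_J2; exact/img_cotangent.
Qed.
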